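(* Let $\Gamma$ be a countable simplicial graph with clique number $\omega(\Gamma)\le k$. Suppose that $\{G_v\}_{v\in V(\Gamma)}$ is a collection of finitely generated groups with $0<\operatorname{asdim}G_v\le n$ for all $v\in V(\Gamma)$. Then, in a left-invariant proper metric, the graph product satisfies $\operatorname{asdim}\Gamma\mathfrak{G}\le nk$.
   Context: The clique number $\omega(\Gamma)$ is the maximum number of vertices of a complete subgraph of $\Gamma$. The graph product $\Gamma\mathfrak{G}$ is the free product of the $G_v$ modulo the relations $gg'=g'g$ for $g\in G_v$, $g'\in G_{v'}$ whenever $\{v,v'\}$ is an edge; it is a countable group. A metric is proper if balls are finite (bounded sets are finite). Finitely generated groups carry a word metric. A metric space $X$ has $\operatorname{asdim}X\le n$ if for every $R>0$, $X$ is a union of $n+1$ families of subsets, each uniformly bounded and $R$-disjoint (distinct members are at distance $>R$). *)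

(* Defs.v *)
From HB Require Import structures.
From mathcomp Require Import all_boot all_order all_algebra.
From mathcomp Require Import boolp classical_sets cardinality Rstruct.
Set Implicit Arguments. Unset Strict Implicit. Unset Printing Implicit Defensive.
Import Order.TTheory GRing.Theory Num.Theory.
Local Open Scope classical_set_scope.
Local Open Scope ring_scope.

Notation Real := Rdefinitions.R.

Definition simplicial_graph (V : Type) (E : rel V) : Prop :=
  (forall x y, E x y = E y x) /\ (forall x, ~~ E x x).

Definition is_clique (V : eqType) (E : rel V) (s : seq V) : Prop :=
  uniq s /\ (forall x y, x \in s -> y \in s -> x != y -> E x y).

Definition clique_number_le (V : eqType) (E : rel V) (k : nat) : Prop :=
  forall s : seq V, is_clique E s -> (size s <= k)%N.

Definition is_hom (G H : groupType) (f : G -> H) : Prop :=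
  forall x y : G, f (x * y)%g = (f x * f y)%g.

(* P together with iota_v : G_v -> P is the graph product of the G_v over
   (V,E): the group given by the free product of the G_v modulo the relations
   g g' = g' g for g in G_v, g' in G_v' with {v,v'} an edge; expressed by its
   universal property (the defining property of a group presentation). *)
Definition is_graph_product (V : Type) (E : rel V) (G : V -> groupType)
    (P : groupType) (iota : forall v, G v -> P) : Prop :=
  [/\ forall v, is_hom (iota v),
      forall v w (g : G v) (h : G w), E v w ->
        (iota v g * iota w h = iota w h * iota v g)%g
    & forall (H : groupType) (f : forall v, G v -> H),
        (forall v, is_hom (f v)) ->
        (forall v w (g : G v) (h : G w), E v w ->
           (f v g * f w h = f w h * f v g)%g) ->
        exists phi : P -> H,
          [/\ is_hom phi,
              (forall v (g : G v), phi (iota v g) = f v g)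
            & forall psi : P -> H, is_hom psi ->
                (forall v (g : G v), psi (iota v g) = f v g) ->
                forall x, psi x = phi x]].

Definition word_len_le (G : groupType) (S : seq G) (g : G) (m : nat) : Prop :=
  exists w : seq G, [/\ (size w <= m)%N,
     all (fun s => (s \in S) || (s^-1 \in S))%g w
   & foldr (fun a b => a * b)%g 1%g w = g].

Definition generates (G : groupType) (S : seq G) : Prop :=
  forall g : G, exists m, word_len_le S g m.

(* word length |g|_S (set to 0 if g is not in the generated subgroup) *)
Definition wordlen (G : groupType) (S : seq G) (g : G) : nat :=
  match pselect (exists m, word_len_le S g m) with
  | left h =>
      @ex_minn (fun m => `[< word_len_le S g m >])
        (let: ex_intro m hm := h in ex_intro _ m (asboolT hm))
  | right _ => 0%N
  end.

Definition word_metric (G : groupType) (S : seq G) (x y : G) : Real :=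
  (wordlen S (x^-1 * y)%g)%:R.

Definition is_metric (X : Type) (d : X -> X -> Real) : Prop :=
  [/\ forall x y, 0 <= d x y,
      forall x y, d x y = 0 <-> x = y,
      forall x y, d x y = d y x
    & forall x y z, d x z <= d x y + d y z].

Definition proper_metric (X : Type) (d : X -> X -> Real) : Prop :=
  forall (x : X) (r : Real), finite_set [set y | d x y <= r].

Definition left_invariant (G : groupType) (d : G -> G -> Real) : Prop :=
  forall g x y : G, d (g * x)%g (g * y)%g = d x y.

Definition asdim_le (X : Type) (d : X -> X -> Real) (n : nat) : Prop :=
  forall r : Real, 0 < r ->
    exists U : 'I_n.+1 -> set (set X),
      [/\ forall x : X, exists i A, U i A /\ A x,
          forall i, exists D : Real,
            forall A, U i A -> forall x y, A x -> A y -> d x y <= D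
        & forall i A B, U i A -> U i B -> A <> B ->
            forall x y, A x -> B y -> r < d x y].

(* Main.v *)
Require Import Defs.
From HB Require Import structures.
From mathcomp Require Import all_boot all_order all_algebra.
From mathcomp Require Import boolp classical_sets cardinality Rstruct.
From mathcomp Require Import zify.
Import Order.TTheory GRing.Theory Num.Theory.
Set Implicit Arguments. Unset Strict Implicit. Unset Printing Implicit Defensive.

(* By properness only finitely many elements of the product have length at most
   [r], and they lie in the subgroup of a finite set of vertices; so only finite
   graphs matter, and these are treated by induction on the number of vertices.
   Removing a vertex [v], the product [P] is the amalgam of [A] (the product over
   the other vertices) and [C * G_v] over [C] (the product over the link of [v],
   whose cliques are smaller). By induction [A] and, by the product theorem,
   [C * G_v] have dimension at most [N = n * k], while [C] has dimension at most
   [N - n < N]. That this gives [asdim P <= N], without the additional [+1] of a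
   Hurewicz type theorem, is seen on the Bass-Serre tree: one cuts along the edges
   at depths [j * L] and inserts [N + 1] consecutive collar layers after each cut;
   a collar is close to a coset of [C], so that [N] colours are enough for it, and
   the [t]-th layer can be coloured without using the colour [t]. *)

(** * Chains and colourings *)

Section Chains.
Local Open Scope group_scope.

Definition prods (P : groupType) (A B : seq P) := [seq a * b | a <- A, b <- B].

(** Steps are right multiplications by elements of [F], so chains are invariant under left
    translation; for [F] a ball of radius [r] about [1], they are the paths with jumps at most
    [r]. *)
Inductive chain (P : groupType) (F : seq P) (Y : P -> Prop) : P -> P -> Prop :=
| chain_nil x : Y x -> chain F Y x x
| chain_cons x y z : Y x -> x^-1 * y \in F -> chain F Y y z -> chain F Y x z.

(** A single finite [D] serves all chain components: this is uniform boundedness. *)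
Definition bounded (P : groupType) (F : seq P) (Y : P -> Prop) (D : seq P) :=
  forall x y, chain F Y x y -> x^-1 * y \in D.

(* [colorable m Y] expresses [asdim Y < m] for a subset [Y] of a countable group
   with a proper left-invariant metric, finite sets playing the role of balls. *)
Definition colorable (P : groupType) (m : nat) (Y : P -> Prop) :=
  forall F : seq P, exists (c : P -> nat) (D : seq P),
    (forall x, Y x -> c x < m) /\
    forall i, bounded F (fun z => Y z /\ c z = i) D.

Lemma mem_prods (P : groupType) (A B : seq P) a b :
  a \in A -> b \in B -> a * b \in prods A B.
Proof. exact: allpairs_f. Qed.

Lemma prodsP (P : groupType) (A B : seq P) z :
  z \in prods A B -> exists a b, [/\ a \in A, b \in B & z = a * b].
Proof. by case/allpairsP=> -[a b] /= [? ? ->]; exists a, b. Qed.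

Lemma divgM (P : groupType) (x y z : P) : x^-1 * z = x^-1 * y * (y^-1 * z).
Proof. by rewrite mulgA mulgK. Qed.

Lemma invdivg (P : groupType) (x y : P) : (x^-1 * y)^-1 = y^-1 * x.
Proof. by rewrite invgM invgK. Qed.

Lemma divgMl (P : groupType) (u x y : P) : (u * x)^-1 * (u * y) = x^-1 * y.
Proof. by rewrite invgM -mulgA mulKg. Qed.

Lemma mem_prods_div (P : groupType) (A B : seq P) x y z :
  x^-1 * y \in A -> y^-1 * z \in B -> x^-1 * z \in prods A B.
Proof. by rewrite (divgM x y z); exact: mem_prods. Qed.

Lemma chain_map (P Q : groupType) (f : P -> Q) F F' (Y : P -> Prop) (Y' : Q -> Prop) :
  (forall x, Y x -> Y' (f x)) ->
  (forall x y, Y x -> Y y -> x^-1 * y \in F -> (f x)^-1 * f y \in F') ->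
  forall x y, chain F Y x y -> chain F' Y' (f x) (f y).
Proof.
move=> fY fF x y; elim=> {x y} [x Yx | x y z Yx xy yz IH].
  by constructor; exact: fY.
apply: chain_cons IH; first exact: fY.
by apply: fF => //; case: yz.
Qed.

Lemma chain_sub (P : groupType) (F F' : seq P) (Y Y' : P -> Prop) :
  (forall x, Y x -> Y' x) -> {subset F <= F'} ->
  forall x y, chain F Y x y -> chain F' Y' x y.
Proof. by move=> sY sF; apply: (chain_map (f := id)) => // x y _ _; exact: sF. Qed.

Lemma chain_ends (P : groupType) (F : seq P) Y x y : chain F Y x y -> Y x /\ Y y.
Proof. by elim=> {x y} // x y z Yx _ _ []. Qed.

Lemma chain_trans (P : groupType) (F : seq P) Y x y z :
  chain F Y x y -> chain F Y y z -> chain F Y x z.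
Proof. by elim=> {x y} // x y w Yx xy _ IH /IH; exact: chain_cons. Qed.

Lemma chain_rcons (P : groupType) (F : seq P) Y x y z :
  chain F Y x y -> y^-1 * z \in F -> Y z -> chain F Y x z.
Proof.
move=> xy yz Yz; apply: (chain_trans xy).
by apply: chain_cons (chain_nil _ Yz) => //; case: (chain_ends xy).
Qed.

Lemma chain_sym (P : groupType) (F : seq P) Y x y :
  (forall z, z \in F -> z^-1 \in F) -> chain F Y x y -> chain F Y y x.
Proof.
move=> symF; elim=> {x y} [x Yx | x y z Yx xy yz IH]; first by constructor.
by apply: (chain_rcons IH) => //; rewrite -invdivg; exact: symF.
Qed.

(** This is how chains are confined to one piece of a decomposition. *)
Lemma chain_inv (P : groupType) (F : seq P) (Y R : P -> Prop) x y :
  (forall a b, Y a -> Y b -> a^-1 * b \in F -> R a -> R b) ->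
  chain F Y x y -> R x -> chain F (fun z => Y z /\ R z) x y.
Proof.
move=> inv; elim=> {x y} [x Yx Rx | x y z Yx xy yz IH Rx].
  by constructor.
have [Yy _] := chain_ends yz.
by apply: (chain_cons _ xy) => //; apply: IH; exact: inv Rx.
Qed.

Lemma bounded_sub (P : groupType) (F F' : seq P) (Y Y' : P -> Prop) D :
  (forall x, Y x -> Y' x) -> {subset F <= F'} -> bounded F' Y' D -> bounded F Y D.
Proof. by move=> sY sF bY x y xy; apply: bY; exact: chain_sub xy. Qed.

(* A chain in the union visits [Q1] with gaps in [FR], because its excursions
   into [Q2] are bounded by [D2]. *)
Lemma bounded_union (P : groupType) (F FR D1 D2 : seq P) (Q1 Q2 : P -> Prop) :
  bounded F Q2 D2 -> bounded FR Q1 D1 ->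
  {subset F <= FR} -> {subset prods (prods F D2) F <= FR} ->
  bounded F (fun z => Q1 z \/ Q2 z)
    (D2 ++ prods (1 :: prods D2 F) (prods D1 (1 :: prods F D2))).
Proof.
move=> b2 b1 FR1 FR2.
(* [pre] and [suf] describe the possible excursions into [Q2] at the start and at the end of the
   chain. *)
pose pre x a := a = x \/ exists2 a', chain F Q2 x a' & a'^-1 * a \in F.
pose suf b y := b = y \/ exists2 b', chain F Q2 b' y & b^-1 * b' \in F.
have key x y : chain F (fun z => Q1 z \/ Q2 z) x y ->
    chain F Q2 x y \/ exists a b, [/\ pre x a, chain FR Q1 a b & suf b y].
  elim=> {x y} [x [q1|q2] | x y z qx xy yz IH].
  - by right; exists x, x; split; [left | constructor | left].
  - by left; constructor.
  case: qx => [q1|q2].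
  - right; exists x; case: IH => [c2|[a [b [pa ab sb]]]].
      by exists x; split; [left | constructor | right; exists y].
    exists b; split=> //; first by left.
    apply: (chain_cons q1 _ ab); case: pa => [->|[a' ya' a'a]]; first exact: FR1.
    apply: FR2; apply: mem_prods_div a'a; apply: mem_prods_div xy _; exact: b2.
  - case: IH => [c2|[a [b [pa ab sb]]]]; first by left; exact: chain_cons c2.
    right; exists a, b; split=> //; right.
    case: pa => [->|[a' ya' a'a]]; first by exists x => //; constructor.
    by exists a' => //; exact: chain_cons ya'.
move=> x y /key[c2|[a [b [pa ab sb]]]]; first by rewrite mem_cat b2.
rewrite mem_cat; apply/orP; right.
apply: (@mem_prods_div _ _ _ x a).
  case: pa => [->|[a' xa' a'a]]; first by rewrite mulVg mem_head.
  by rewrite inE; apply/orP; right; apply: mem_prods_div a'a; exact: b2.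
apply: (@mem_prods_div _ _ _ a b); first exact: b1.
case: sb => [->|[b' b'y bb']]; first by rewrite mulVg mem_head.
by rewrite inE; apply/orP; right; apply: mem_prods_div bb' _; exact: b2.
Qed.

Lemma colorable_leq (P : groupType) m m' (Y : P -> Prop) :
  m <= m' -> colorable m Y -> colorable m' Y.
Proof.
move=> mm' cY F; have [c [D [cm bD]]] := cY F; exists c, D; split=> // x /cm cx.
exact: leq_trans cx mm'.
Qed.

(** Colours are pulled back along the coarse embedding [f]: the second hypothesis carries chains
    forward, the third carries bounds back. *)
Lemma colorable_coarse (P Q : groupType) (f : P -> Q) m
    (Y : P -> Prop) (Y' : Q -> Prop) :
  (forall x, Y x -> Y' (f x)) ->
  (forall F : seq P, exists F' : seq Q, forall x y, Y x -> Y y ->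
     x^-1 * y \in F -> (f x)^-1 * f y \in F') ->
  (forall D' : seq Q, exists D : seq P, forall x y, Y x -> Y y ->
     (f x)^-1 * f y \in D' -> x^-1 * y \in D) ->
  colorable m Y' -> colorable m Y.
Proof.
move=> fY fF fD cY' F; have [F' FF'] := fF F.
have [c [D' [cm bD']]] := cY' F'; have [D DD'] := fD D'.
exists (c \o f), D; split=> [x /fY/cm // | i x y xy].
have [[Yx _] [Yy _]] := chain_ends xy.
apply: DD' => //; apply: (bD' i); apply: chain_map xy => z.
  by case=> /fY.
by move=> w [Yz _] [Yw _]; exact: FF'.
Qed.

Lemma colorable_sub (P : groupType) m (Y Y' : P -> Prop) :
  (forall x, Y x -> Y' x) -> colorable m Y' -> colorable m Y.
Proof.
by move=> sY; apply: (colorable_coarse (f := id)) => // F; exists F.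
Qed.

(** Choosing for each point a nearby point of [Y] is a coarse embedding. *)
Lemma colorable_thicken (P : groupType) m (Y : P -> Prop) (B : seq P) :
  colorable m Y -> colorable m (fun z => exists2 x, Y x & x^-1 * z \in B).
Proof.
have /choice[f fP] : forall z, exists x,
    (exists2 x, Y x & x^-1 * z \in B) -> Y x /\ x^-1 * z \in B.
  move=> z; have [[x Yx xz]|nz] := pselect (exists2 x, Y x & x^-1 * z \in B).
    by exists x.
  by exists 1.
pose B' := [seq b^-1 | b <- B].
have mB' x y : x^-1 * y \in B -> y^-1 * x \in B'.
  by move=> xy; rewrite -invdivg; exact: map_f.
apply: (colorable_coarse (f := f)) => [x /fP[] //|F|D].
  exists (prods B (prods F B')) => x y /fP[_ xB] /fP[_ yB] xy.
  apply: mem_prods_div xB _; apply: mem_prods_div xy _; exact: mB'.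
exists (prods B' (prods D B)) => x y /fP[_ xB] /fP[_ yB] xy.
by apply: mem_prods_div (mB' _ _ xB) _; exact: mem_prods_div xy yB.
Qed.

End Chains.

(** * Products *)

Section Products.
Local Open Scope group_scope.

Lemma count_sub_eq (a b : pred nat) (s : seq nat) :
  (forall i, a i -> b i) -> count b s <= count a s ->
  forall i, i \in s -> b i -> a i.
Proof.
move=> ab; elim: s => [//|j s IH] /= le_s i.
have le_ab : count a s <= count b s by apply: sub_count.
have := ab j; rewrite inE => abj /predU1P[->|]; last by apply: IH; lia.
by move: abj le_s; case: (a j); case: (b j) => //=; lia.
Qed.

(** Replacing the points of a chain by nearby points of [Y] turns steps in [F] into steps in
    [B F B]. *)
Lemma bounded_thicken (P : groupType) (F B : seq P) (Y : P -> Prop) :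
  (forall b, b \in B -> b^-1 \in B) -> forall D,
  bounded (prods B (prods F B)) Y D ->
  bounded F (fun z => exists2 x, Y x & x^-1 * z \in B) (prods B (prods D B)).
Proof.
move=> symB D bY.
have /choice[f fP] : forall z, exists x,
    (exists2 x, Y x & x^-1 * z \in B) -> Y x /\ x^-1 * z \in B.
  move=> z; have [[x Yx xz]|nz] := pselect (exists2 x, Y x & x^-1 * z \in B).
    by exists x.
  by exists 1.
have fP' z : (exists2 x, Y x & x^-1 * z \in B) -> z^-1 * f z \in B.
  by move=> /fP[_ /symB]; rewrite invdivg.
move=> x y xy; have [tx ty] := chain_ends xy.
apply: mem_prods_div (fP' _ tx) (mem_prods_div (bY (f x) (f y) _) (fP _ ty).2).
apply: chain_map xy => [z /fP[]//|z w tz tw zw].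
exact: mem_prods_div (fP _ tz).2 (mem_prods_div zw (fP' _ tw)).
Qed.

(* Kolmogorov's trick: the additional family consists of the points lying in
   the least possible number of thickened members; the set of families
   containing such a point is constant along chains. *)
Lemma colorable_multicover (P : groupType) n (Y : P -> Prop) m :
  colorable n.+1 Y -> forall F, exists (U : nat -> P -> bool) (D : seq P),
    (forall y, Y y -> m < count (U^~ y) (iota 0 (n + m).+1)) /\
    forall i, i < (n + m).+1 -> bounded F (fun z => Y z /\ U i z) D.
Proof.
move=> cY; elim: m => [|m IH] F.
  have [c [D [cm bD]]] := cY F; exists (fun i y => c y == i), D; split.
    move=> y /cm cy; rewrite -has_count; apply/hasP; exists (c y) => //.
    by rewrite mem_iota; lia.
  by move=> i _; apply: bounded_sub (bD i) => // x [Yx /eqP].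
pose B := 1 :: F ++ [seq f^-1 | f <- F].
have symB b : b \in B -> b^-1 \in B.
  rewrite !inE !mem_cat => /orP[/eqP->|/orP[bF|/mapP[f fF ->]]].
  - by rewrite invg1 eqxx.
  - by rewrite map_f ?orbT.
  - by rewrite invgK fF orbT.
have subB : {subset F <= B} by move=> f fF; rewrite inE mem_cat fF orbT.
(* The larger scale keeps the members separated after thickening by [B]. *)
have [U [D [Um bU]]] := IH (prods B (prods F B)).
set K := (n + m).+1 in Um bU.
pose V i y := `[< exists2 x, Y x /\ U i x & x^-1 * y \in B >].
pose W i y := if i == K then count (V^~ y) (iota 0 K) == m.+1 else V i y.
exists W, (prods B (prods D B)).
have -> : (n + m.+1).+1 = K.+1 by rewrite /K; lia.
have bV i : i < K -> bounded F (fun z => Y z /\ V i z) (prods B (prods D B)).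
  by move=> /bU/(bounded_thicken symB); apply: bounded_sub => // z [_ /asboolP].
have UV y i : Y y -> U i y -> V i y.
  by move=> Yy Ui; apply/asboolP; exists y => //; rewrite mulVg mem_head.
have lemV y : Y y -> m < count (V^~ y) (iota 0 K).
  move=> Yy; apply: leq_trans (Um y Yy) _; apply: sub_count => i; exact: UV.
have WV y : count (W^~ y) (iota 0 K) = count (V^~ y) (iota 0 K).
  apply: eq_in_count => i; rewrite mem_iota /W add0n => /andP[_ iK].
  by rewrite ifN // ltn_eqF.
split=> [y Yy|i].
  rewrite -[K.+1]addn1 iotaD count_cat WV /= add0n addn0 /W eqxx.
  by have := lemV y Yy; case: eqP => /=; lia.
rewrite ltnS leq_eqVlt => /predU1P[->|iK]; last first.
  apply: bounded_sub (bV i iK) => // z; rewrite /W ifN //.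
  by rewrite ltn_eqF.
move=> x y xy; have [[Yx Wx] _] := chain_ends xy.
have /hasP[j] : has (V^~ x) (iota 0 K) by rewrite has_count; have := lemV x Yx; lia.
rewrite mem_iota add0n => /andP[_ jK] Vx.
apply: (bV j jK); apply: chain_sub (chain_inv (R := V j) _ xy Vx) => //.
  by move=> z [[]].
(* At least [m.+1] sets [U] contain [b], and they are among the exactly [m.+1] thickened sets
   containing [a]; so the indices coincide. *)
move=> a b [Ya]; rewrite /W eqxx => /eqP Wa [Yb] _ ab Va.
apply: UV => //.
apply: (@count_sub_eq (U^~ b) (V^~ a) (iota 0 K)) Va; last by rewrite mem_iota.
  move=> l Ul; apply/asboolP; exists b => //.
  by rewrite -invdivg; apply: symB; exact: subB.
by rewrite Wa; exact: Um.
Qed.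

Lemma count_overlap (a b : pred nat) (s : seq nat) :
  size s < count a s + count b s -> exists i, [/\ i \in s, a i & b i].
Proof.
rewrite -count_predUI -[size s]addn0 => ab.
have /hasP[i si /andP[ai bi]] : has (predI a b) s.
  rewrite has_count; have := count_size (predU a b) s; lia.
by exists i.
Qed.

(** Among [n1 + n2 + 1] families, a point of [Y1] lies in at least [n2 + 1] and a point of [Y2] in
    at least [n1 + 1]; a common index is the colour. *)
Lemma colorable_prod (P P1 P2 : groupType) (p1 : P -> P1) (p2 : P -> P2) n1 n2
    (Y : P -> Prop) (Y1 : P1 -> Prop) (Y2 : P2 -> Prop) :
  is_hom p1 -> is_hom p2 ->
  (forall x, Y x -> Y1 (p1 x)) -> (forall x, Y x -> Y2 (p2 x)) ->
  (forall (D1 : seq P1) (D2 : seq P2), exists D : seq P, forall x y, Y x -> Y y ->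
     (p1 x)^-1 * p1 y \in D1 -> (p2 x)^-1 * p2 y \in D2 -> x^-1 * y \in D) ->
  colorable n1.+1 Y1 -> colorable n2.+1 Y2 -> colorable (n1 + n2).+1 Y.
Proof.
move=> h1 h2 Y1P Y2P DP c1 c2 F.
have hV (Q : groupType) (p : P -> Q) : is_hom p -> forall x y,
    (p x)^-1 * p y = p (x^-1 * y).
  by move=> hp x y; apply: (mulgI (p x)); rewrite mulVKg -hp mulVKg.
have [U1 [D1 [m1 b1]]] := colorable_multicover n2 c1 [seq p1 f | f <- F].
have [U2 [D2 [m2 b2]]] := colorable_multicover n1 c2 [seq p2 f | f <- F].
have [D DD] := DP D1 D2.
rewrite [(n2 + n1)%N]addnC in m2 b2.
have /choice[c cP] : forall x, exists i, Y x ->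
    [/\ i < (n1 + n2).+1, U1 i (p1 x) & U2 i (p2 x)].
  move=> x; have [Yx|] := pselect (Y x); last by exists 0%N.
  have [|i [si u1 u2]] := @count_overlap (U1^~ (p1 x)) (U2^~ (p2 x)) (iota 0 (n1 + n2).+1).
    by rewrite size_iota; have := m1 _ (Y1P _ Yx); have := m2 _ (Y2P _ Yx); lia.
  by exists i => _; split=> //; rewrite mem_iota in si.
exists c, D; split=> [x /cP[] //|i x y xy].
have [[Yx cx] [Yy cy]] := chain_ends xy; have [i_lt _ _] := cP _ Yx.
rewrite cx in i_lt.
apply: DD => //; [apply: (b1 i) | apply: (b2 i)] => //; apply: chain_map xy.
- by move=> z [Yz <-]; split; [exact: Y1P | case: (cP _ Yz)].
- by move=> z w _ _ zw; rewrite hV // map_f.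
- by move=> z [Yz <-]; split; [exact: Y2P | case: (cP _ Yz)].
- by move=> z w _ _ zw; rewrite hV // map_f.
Qed.

End Products.

(** * Amalgams *)

Section Balls.
Local Open Scope group_scope.
Variable P : groupType.
Implicit Types (T : seq P) (x y f : P).

Fixpoint ball T r : seq P := if r is r'.+1 then prods (1 :: T) (ball T r') else [:: 1].

Lemma ball1 T r : 1 \in ball T r.
Proof.
elim: r => [|r IH] /=; first exact: mem_head.
by rewrite -{1}[1]mulg1; apply: mem_prods => //; exact: mem_head.
Qed.

Lemma ballM T r s x y : x \in ball T r -> y \in ball T s -> x * y \in ball T (r + s).
Proof.
elim: r x => [|r IH] x /=; first by rewrite inE => /eqP->; rewrite mul1g.
by case/prodsP=> t [z [tT zr ->]] ys; rewrite -mulgA mem_prods // IH.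
Qed.

Lemma mem_ball1 T x : x \in T -> x \in ball T 1.
Proof.
by move=> xT; rewrite -[x]mulg1 /= mem_prods ?mem_head // inE xT orbT.
Qed.

Lemma ball_leq T r s : r <= s -> {subset ball T r <= ball T s}.
Proof. by move=> rs x xr; rewrite -(subnKC rs) -[x]mulg1 ballM ?ball1. Qed.

Lemma ballV T r x : (forall t, t \in T -> t^-1 \in T) ->
  x \in ball T r -> x^-1 \in ball T r.
Proof.
move=> symT; elim: r x => [|r IH] x /=; first by rewrite !inE => /eqP->; rewrite invg1.
case/prodsP=> t [z [tT zr ->]]; rewrite invgM.
suff : z^-1 * t^-1 \in ball T (r + 1) by rewrite addn1.
apply: ballM; first exact: IH.
move: tT; rewrite inE => /orP[/eqP->|/symT/mem_ball1//].
by rewrite invg1 ball1.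
Qed.

Lemma ball_sub T T' r : {subset T <= T'} -> {subset ball T r <= ball T' r}.
Proof.
move=> sT; elim: r => [//|r IH] x /prodsP[t [z [tT /IH zr ->]]].
by apply: mem_prods => //; move: tT; rewrite !inE => /orP[->//|/sT->]; rewrite orbT.
Qed.

Lemma mem_ball_foldr T (ts : seq P) : {subset ts <= T} ->
  foldr (fun a b => a * b) 1 ts \in ball T (size ts).
Proof.
elim: ts => [|t ts IH] sT /=; first exact: mem_head.
apply: mem_prods; first by rewrite inE sT ?mem_head ?orbT.
by apply: IH => z zts; apply: sT; rewrite inE zts orbT.
Qed.

(** Bounded steps inside [Q] are thus broken into letters from a finite symmetric set, which can be
    followed one by one in the tree. *)
Lemma sub_ball (L Q : P -> Prop) (F : seq P) :
  (forall t, L t -> L t^-1) ->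
  (forall f, Q f -> exists ts : seq P, (forall t, t \in ts -> L t) /\
     f = foldr (fun a b => a * b) 1 ts) ->
  exists T r, [/\ forall t, t \in T -> L t, forall t, t \in T -> t^-1 \in T
    & forall f, f \in F -> Q f -> f \in ball T r].
Proof.
move=> LV genQ; elim: F => [|f F [T [r [LT symT FT]]]]; first by exists [::], 0%N.
have [/genQ[ts [Lts f_eq]]|nQ] := pselect (Q f); last first.
  exists T, r; split=> // z; rewrite inE => /orP[/eqP-> //|]; exact: FT.
exists (ts ++ [seq t^-1 | t <- ts] ++ T), (maxn (size ts) r); split.
- move=> t; rewrite !mem_cat => /orP[/Lts//|/orP[/mapP[s /Lts Ls ->]|/LT//]].
  exact: LV.
- move=> t; rewrite !mem_cat => /orP[tts|/orP[/mapP[s sts ->]|/symT->]].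
  + by rewrite map_f // orbT.
  + by rewrite invgK sts.
  + by rewrite !orbT.
- move=> z; rewrite inE => /orP[/eqP-> _|zF Qz].
    apply: (ball_leq (leq_maxl _ _)); rewrite f_eq; apply: mem_ball_foldr => t tts.
    by rewrite mem_cat tts.
  apply: (ball_leq (leq_maxr _ _)); apply: ball_sub (FT _ zF Qz) => t tT.
  by rewrite !mem_cat tT !orbT.
Qed.

End Balls.

(** * Colouring a group that acts on a tree *)

Section Amalgam.
Local Open Scope group_scope.

(* The subgroup [Q] acts on a tree: [W x] is the reduced word leading from the
   base edge to the edge of [x], with its last syllable first; syllables have the
   type of the vertex group [M true] or [M false] they come from; [e u] is a
   representative of the coset, of the edge group, of all elements with word [u]. *)
Variables (P : groupType) (Syl : Type) (Q : P -> Prop) (M : bool -> P -> Prop).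
Variables (W : P -> seq Syl) (ty : Syl -> bool) (e : seq Syl -> P).
Hypothesis QM : forall x y, Q x -> Q y -> Q (x * y).
Hypothesis QV : forall x, Q x -> Q x^-1.
Hypothesis MQ : forall b x, M b x -> Q x.
Hypothesis MV : forall b x, M b x -> M b x^-1.
Hypothesis genQ : forall f, Q f -> exists ts : seq P,
  (forall t, t \in ts -> exists b, M b t) /\ f = foldr (fun a b => a * b) 1 ts.
(** The edges of [y] and [y * t] share a vertex of type [b], so their words differ at most in a head
    syllable of this type. *)
Hypothesis W_step : forall y b t, Q y -> M b t -> exists u,
  (W y = u \/ exists2 s, ty s = b & W y = s :: u) /\
  (W (y * t) = u \/ exists2 s, ty s = b & W (y * t) = s :: u).
(** Translation by the inverse of [e u] makes the edge with word [u] the new base edge. *)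
Hypothesis W_cat : forall y w u, Q y -> W y = w ++ u ->
  Q (e u) /\ W ((e u)^-1 * y) = w.
Hypothesis W_seq1 : forall y s, Q y -> W y = [:: s] -> M (ty s) y.

Lemma Qdiv x y : Q x -> Q y -> Q (x^-1 * y).
Proof. by move=> /QV; exact: QM. Qed.

Let letter t := exists b, M b t.

Lemma letterV t : letter t -> letter t^-1.
Proof. by case=> b /MV; exists b. Qed.

Section Fixed_letters.
Variable T : seq P.
Hypothesis letterT : forall t, t \in T -> letter t.
Hypothesis symT : forall t, t \in T -> t^-1 \in T.

Lemma size_ball r y f : Q y -> f \in ball T r -> size (W (y * f)) <= size (W y) + r.
Proof.
elim: r y f => [|r IH] y f Qy /=.
  by rewrite inE => /eqP->; rewrite mulg1 addn0.
case/prodsP=> t [g [tT gr ->]]; rewrite mulgA.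
move: tT; rewrite inE => /orP[/eqP->|/letterT[b Mt]].
  by rewrite mulg1 addnS leqW // IH.
have Qyt : Q (y * t) by apply: QM => //; exact: MQ Mt.
apply: leq_trans (IH _ _ Qyt gr) _; rewrite addnS -addSn leq_add2r.
by have [u [[->|[s _ ->]] [->|[s' _ ->]]]] := W_step Qy Mt => //=; rewrite ltnW.
Qed.

Lemma size_step r x y : Q x -> x^-1 * y \in ball T r -> size (W y) <= size (W x) + r.
Proof. by move=> Qx /(size_ball Qx); rewrite mulVKg. Qed.

Lemma ball_sym r x y : x^-1 * y \in ball T r -> y^-1 * x \in ball T r.
Proof. by rewrite -(invdivg x y); apply: ballV. Qed.

(** By [W_cat] the points with word [u] lie in one coset of the edge group; this is a neighbourhood
    of them. *)
Definition near k u y := exists x, [/\ Q x, W x = u & x^-1 * y \in ball T k].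

Lemma near_leq k l u y : k <= l -> near k u y -> near l u y.
Proof. by move=> kl [x [Qx Wx xy]]; exists x; split=> //; exact: ball_leq kl _ xy. Qed.

Lemma near_step k l u x y :
  near k u x -> x^-1 * y \in ball T l -> near (k + l) u y.
Proof.
move=> [z [Qz Wz zx]] xy; exists z; split=> //.
by rewrite (divgM z x y); exact: ballM.
Qed.

(* In a tree, the root edge of a branch separates the branch from the rest. *)
Lemma branch_exit r x y w s u :
  Q x -> x^-1 * y \in ball T r -> W x = w ++ s :: u ->
  (exists w' s', ty s' = ty s /\ W y = w' ++ s' :: u) \/ near r u x.
Proof.
move=> Qx; rewrite -{2}(mulVKg x y); move: (x^-1 * y) => f.
elim: r x w s f Qx => [|r IH] x w s f Qx /=.
  by rewrite inE => /eqP-> Wx; rewrite mulg1; left; exists w, s.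
case/prodsP=> t [g [tT gr ->]] Wx; rewrite mulgA.
have t1 : t^-1 \in ball T 1.
  apply: ballV => //; move: tT; rewrite inE => /orP[/eqP->|/mem_ball1//].
  exact: ball1.
have near_t : near r u (x * t) -> near r.+1 u x.
  by rewrite -addn1 => /near_step; apply; rewrite invgM mulgVK.
move: tT; rewrite inE => /orP[/eqP->|/letterT[b Mt]].
  rewrite mulg1; case: (IH _ _ _ _ Qx gr Wx) => [|n]; [by left|right].
  exact: near_leq n.
have Qxt : Q (x * t) by apply: QM => //; exact: MQ Mt.
(* A letter can alter [s] only if [w] is empty; it then removes [s] or replaces it by a syllable of
   the same type. *)
have : W (x * t) = u \/ exists w' s', ty s' = ty s /\ W (x * t) = w' ++ s' :: u.
  have [v [Wv Wtv]] := W_step Qx Mt.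
  case: Wv => [Wv|[s0 ty0 Wv]]; rewrite Wx in Wv.
    right; case: Wtv => [->|[s1 _ ->]]; rewrite -Wv; first by exists w, s.
    by exists (s1 :: w), s.
  case: w {Wx} Wv => [|s2 w] [? ?]; subst s0 v.
    case: Wtv => [->|[s1 ty1 ->]]; [by left | right; exists [::], s1].
    by rewrite ty1.
  right; case: Wtv => [->|[s1 _ ->]]; first by exists w, s.
  by exists (s1 :: w), s.
case=> [Wxt|[w' [s' [tys Wxt]]]].
  right; exists (x * t); split=> //; rewrite invgM mulgVK.
  by apply: ball_leq t1.
case: (IH _ _ _ _ Qxt gr Wxt) => [[w1 [s1 [ty1 ->]]]|n]; last by right; exact: near_t.
by left; exists w1, s1; rewrite ty1.
Qed.

End Fixed_letters.
Let Cedge x := Q x /\ W x = [::].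

Lemma shift_div u x y : ((e u)^-1 * x)^-1 * ((e u)^-1 * y) = x^-1 * y.
Proof. exact: divgMl. Qed.

Lemma letters_ball (F : seq P) : exists T r, [/\ forall t, t \in T -> letter t,
  forall t, t \in T -> t^-1 \in T & forall x y, Q x -> Q y ->
    x^-1 * y \in F -> x^-1 * y \in ball T r].
Proof.
have [T [r [LT sT FT]]] := sub_ball F letterV genQ.
by exists T, r; split=> // x y Qx Qy xyF; apply: FT => //; exact: Qdiv.
Qed.

(* Far from the shorter words, words of length [j.+1] split into cosets of the
   vertex groups. *)
Lemma colorable_short N j : (forall b, colorable N.+1 (M b)) -> colorable N.+1 Cedge ->
  colorable N.+1 (fun y => Q y /\ size (W y) <= j).
Proof.
move=> cM cC; elim: j => [|j IH].
  by apply: colorable_sub cC => x [Qx]; rewrite leqn0 => /eqP/size0nil.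
move=> F; have [T [r [LT sT FT]]] := letters_ball F.
pose B := ball T r.
have /choice[cb cbP] b := cM b F; have /choice[Db bDb] := cbP.
pose DZ := Db true ++ Db false.
pose thick z := exists2 x, Q x /\ size (W x) <= j & x^-1 * z \in B.
(* The scale is the one that [bounded_union] asks for when the excursions into the thin part are
   bounded by [DZ]. *)
have [c1 [D1 [c1N b1]]] :=
  colorable_thicken B IH (F ++ prods (prods F DZ) F).
pose c2 y := if W y is s :: u then cb (ty s) ((e u)^-1 * y) else 0%N.
pose c y := if `[< thick y >] then c1 y else c2 y.
exists c, (DZ ++ prods (1 :: prods DZ F) (prods D1 (1 :: prods F DZ))).
have thin y : Q y -> size (W y) <= j.+1 -> ~ thick y -> exists s u,
    [/\ W y = s :: u, size u = j & M (ty s) ((e u)^-1 * y)].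
  move=> Qy; case Wy: (W y) => [|s u]; rewrite /= ?ltnS => sz thk.
    by case: thk; exists y; rewrite ?Wy ?mulVg ?ball1.
  have [Qe Wey] : Q (e u) /\ W ((e u)^-1 * y) = [:: s] by apply: W_cat.
  exists s, u; split=> //; last by apply: W_seq1 => //; exact: Qdiv.
  apply/eqP; rewrite eqn_leq sz leqNgt; apply/negP => lt_uj.
  by case: thk; exists y; rewrite ?Wy ?mulVg ?ball1.
split=> [y [Qy sz]|i].
  rewrite /c; case: asboolP => [/c1N//|/(thin _ Qy sz)[s [u [Wy _ My]]]].
  by rewrite /c2 Wy; case: (bDb (ty s)) => cN _; exact: cN.
pose Q1 z := thick z /\ c1 z = i.
pose Q2 z := [/\ Q z, size (W z) <= j.+1, ~ thick z & c2 z = i].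
apply: (@bounded_sub _ F F _ (fun z => Q1 z \/ Q2 z)) => //.
  by move=> z [[Qz sz]]; rewrite /c; case: asboolP; [left | right].
apply: (@bounded_union _ F (F ++ prods (prods F DZ) F)).
- move=> x y xy; have [[Qx szx thx cx] _] := chain_ends xy.
  have [s [u [Wx szu _]]] := thin _ Qx szx thx.
  (* A step leaving the branches at [u] would start close to points with word [u], whose length is
     [j]; such a start is thick. *)
  have inv a b : Q2 a -> Q2 b -> a^-1 * b \in F ->
      (exists2 s', ty s' = ty s & W a = s' :: u) ->
      (exists2 s', ty s' = ty s & W b = s' :: u).
    move=> [Qa _ tha _] [Qb szb _ _] ab [s' tys Wa].
    have [[w [s2 [ty2 Wb]]]|[z [Qz Wz za]]] :=
        @branch_exit T LT sT r a b [::] s' u Qa (FT _ _ Qa Qb ab) Wa.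
      exists s2; first by rewrite ty2.
      rewrite Wb in szb *; suff /size0nil-> : size w = 0%N by [].
      move: szb; rewrite size_cat /= szu addnS ltnS -{2}[j]add0n leq_add2r.
      by rewrite leqn0 => /eqP.
    by case: tha; exists z; rewrite ?Wz ?szu.
  have xy' : x^-1 * y \in Db (ty s).
    rewrite -(shift_div u); case: (bDb (ty s)) => _ /(_ i); apply.
    apply: chain_map (chain_inv inv xy _); last by exists s.
      move=> z [[Qz szz thz cz] [s' tys Wz]].
      have [s2 [u2 []]] := thin _ Qz szz thz.
      rewrite Wz => -[<- <-] _ Mz; rewrite -tys; split=> //.
      by move: cz; rewrite /c2 Wz.
    by move=> z w _ _; rewrite shift_div.
  by rewrite mem_cat; move: xy'; case: (ty s) => ->; rewrite ?orbT.
- exact: (b1 i).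
- by move=> f fF; rewrite mem_cat fF.
- by move=> f fF; rewrite mem_cat fF orbT.
Qed.

(** * Cuts and collars *)

Section Layers.
Variables (T : seq P) (r N : nat).
Hypothesis letterT : forall t, t \in T -> letter t.
Hypothesis symT : forall t, t \in T -> t^-1 \in T.

(** A collar reaches to distance [N.+2 * r] from its cut; [L] exceeds this by more than one step
    [r], which keeps successive collars apart. *)
Let L := ((N + 3) * r.+1)%N.

(* The edge at depth [j * L] above [y] (words list their last syllable first). *)
Definition anc j y := drop (size (W y) - (j * L)%N) (W y).

(* [y] lies below the cut edge [anc j y] and beyond the first [t] layers, each of
   width [r], of the collar of this edge; there is no cut at depth [0]. *)
Definition deep j t y :=
  j = 0%N \/ (j * L)%N < size (W y) /\ ~ near T (t.+1 * r)%N (anc j y) y.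

Lemma anc0 y : anc 0 y = [::].
Proof. by rewrite /anc subn0 drop_size. Qed.

Lemma size_anc j y : (j * L)%N < size (W y) -> size (anc j y) = (j * L)%N.
Proof. by move=> jL; rewrite size_drop subKn // ltnW. Qed.

Lemma W_anc j y : W y = take (size (W y) - (j * L)%N) (W y) ++ anc j y.
Proof. by rewrite cat_take_drop. Qed.

Lemma anc_cons j y : (j * L)%N < size (W y) -> exists w s, W y = w ++ s :: anc j y.
Proof.
move=> jL; move: (W_anc j y); case/lastP: (take _ _) => [|w s] Wy.
  by have /= E := congr1 size Wy; move: (jL); rewrite E size_anc // ltnn.
by exists w, s; rewrite -cat_rcons.
Qed.

Lemma deep_le j t t' y : t' <= t -> deep j t y -> deep j t' y.
Proof.
move=> tt' [->|[jL far]]; [by left | right; split=> // n]; apply: far.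
by apply: near_leq n; rewrite leq_mul2r ltnS tt' orbT.
Qed.

(** Such a point is more than [L] deeper than the cut number [k > 0], and a letter changes the
    length of a word by at most one. *)
Lemma deep_anc j k t t' y : deep j.+1 t y -> k <= j -> t' <= N.+2 -> deep k t' y.
Proof.
move=> [//|[jL _]] kj t'N; case: k kj => [|k] kj; [by left | right].
have kL : (k.+1 * L)%N + L <= (j.+1 * L)%N by rewrite -mulSnr leq_mul2r ltnS kj orbT.
have lt_kL : (k.+1 * L)%N < size (W y).
  by apply: leq_ltn_trans jL; apply: leq_trans kL; rewrite leq_addr.
split=> // -[x [Qx Wx xy]]; have := size_step letterT Qx xy.
rewrite Wx size_anc //; apply/negP; rewrite -ltnNge.
apply: leq_ltn_trans jL; apply: leq_trans kL; rewrite leq_add2l.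
by rewrite leq_mul //; lia.
Qed.

(** Even layer [0] stays more than [r] away from the cut edge, so by [branch_exit] one step cannot
    cross the cut. *)
Lemma deep_step j x y : Q x -> x^-1 * y \in ball T r -> deep j 0 x ->
  anc j y = anc j x /\ (j = 0%N \/ (j * L)%N < size (W y)).
Proof.
move=> Qx xy [->|[jL far]]; first by rewrite !anc0; split=> //; left.
have [w [s Wx]] := anc_cons jL.
have [[w' [s' [_ Wy]]]|n] := branch_exit letterT symT Qx xy Wx; last first.
  by case: far; rewrite mul1n.
have sz : size (W y) = (size w' + (j * L)%N.+1)%N.
  by rewrite Wy size_cat /= size_anc.
have lt_jL : (j * L)%N < size (W y) by rewrite sz; lia.
split; last by right.
rewrite {1}/anc; have -> : (size (W y) - (j * L)%N = (size w').+1)%N by rewrite sz; lia.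
by rewrite Wy -cat_rcons drop_size_cat // size_rcons.
Qed.

(** Layers have width [r], so a step moves back by at most one of them. *)
Lemma deep_stepS j t x y : Q x -> x^-1 * y \in ball T r ->
  deep j t.+1 x -> deep j t y.
Proof.
move=> Qx xy dx; have [a_eq [->|jL]] := deep_step Qx xy (deep_le (leq0n _) dx).
  by left.
case: dx => [->|[_ far]]; [by left | right; split=> // n; apply: far].
rewrite a_eq in n; rewrite mulSn addnC; apply: (near_step n).
exact: ball_sym.
Qed.

Lemma deep_max t y : exists j, deep j t y /\ ~ deep j.+1 t y.
Proof.
have : exists j, ~ deep j.+1 t y.
  exists (size (W y)) => -[//|[+ _]]; rewrite /L; nia.
case=> j; elim: j => [|j IH] nj; first by exists 0%N; split=> //; left.
by have [dj|/IH//] := pselect (deep j.+1 t y); exists j.+1.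
Qed.

Lemma deep_layer j y : deep j 0 y -> ~ deep j N.+1 y ->
  exists2 t, t <= N & deep j t y /\ ~ deep j t.+1 y.
Proof.
elim: N => [|m IH] d0 nd; first by exists 0%N.
have [dm|ndm] := pselect (deep j m.+1 y); first by exists m.+1.
by have [t tm dt] := IH d0 ndm; exists t => //; exact: leqW.
Qed.

End Layers.

Definition skip t a := if a < t then a else a.+1.

Lemma skip_lt t a n : a < n -> skip t a < n.+1.
Proof. by rewrite /skip; case: (ltnP a t); lia. Qed.

Lemma skip_neq t a : skip t a <> t.
Proof. by rewrite /skip; case: (ltnP a t); lia. Qed.

(* Layer [t] of each collar only uses the colours other than [t], so that no
   monochromatic chain crosses a collar: it stays within one region, and its
   excursions into collars are bounded by the colouring of the edge group. *)
Theorem colorable_amalgam N : (forall b, colorable N.+1 (M b)) -> colorable N Cedge ->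
  colorable N.+1 Q.
Proof.
move=> cM cC F; have [T [r [LT sT FT]]] := letters_ball F.
pose L := ((N + 3) * r.+1)%N.
(* After translation this contains every collar: layer [t <= N] lies within [t.+2 * r] of its cut
   edge. *)
pose CB z := exists2 x, Cedge x & x^-1 * z \in ball T (N.+2 * r)%N.
have [cc [DC [ccN bC]]] : exists (c : P -> nat) (D : seq P),
    (forall x, CB x -> c x < N) /\ forall i, bounded F (fun z => CB z /\ c z = i) D.
  exact: colorable_thicken cC F.
pose FR := F ++ prods (prods F DC) F.
(* The extra [r] accounts for points past the next cut but not yet in its layer [0]. *)
have [cy [DY [cyN bY]]] := colorable_short (L + r) cM (colorable_leq (leqnSn N) cC) FR.
pose g j y := (e (anc r N j y))^-1 * y.
pose dp := deep T r N.
have dmono j t t' y : t' <= t -> dp j t y -> dp j t' y := @deep_le T r N j t t' y.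
have WG j y : Q y -> Q (g j y) /\ size (W y) = (size (W (g j y)) + size (anc r N j y))%N.
  move=> Qy; have Wy := W_anc r N j y; have [Qe Wg] := W_cat Qy Wy.
  split; first exact: Qdiv.
  by rewrite /g Wg {1}Wy size_cat.
have nearCB j k y : Q y -> near T k (anc r N j y) y ->
    exists2 x, Cedge x & x^-1 * g j y \in ball T k.
  move=> Qy [x [Qx Wx xy]]; have [Qe We] := W_cat (w := [::]) Qx Wx.
  by exists ((e (anc r N j y))^-1 * x); [split=> //; exact: Qdiv | rewrite divgMl].
pose layer y i j t := [/\ t <= N, dp j t y, ~ dp j t.+1 y, CB (g j y)
  & i = skip t (cc (g j y))].
pose core y i j := [/\ dp j N.+1 y, size (W (g j y)) <= L + r & i = cy (g j y)].
pose spec y i j := [/\ dp j 0 y, ~ dp j.+1 0 y & core y i j \/ exists t, layer y i j t].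
have /choice[c cP] : forall y, exists i, Q y -> i < N.+1 /\ exists j, spec y i j.
  move=> y; have [Qy|] := pselect (Q y); last by exists 0%N.
  have [j [dj ndj]] := @deep_max T r N 0 y.
  have [Qg szg] := WG j y Qy.
  have [dN|ndN] := pselect (dp j N.+1 y).
    exists (cy (g j y)) => _.
    have sz : size (W (g j y)) <= L + r.
      have [szy|szy] := leqP (size (W y)) (j.+1 * L)%N.
        case: dj => [j0|[jL _]].
          by move: szg szy; rewrite j0 anc0 addn0 mul1n => <-; lia.
        by move: szg szy; rewrite size_anc // mulSn -/L; lia.
      have [x [Qx Wx /(size_step LT Qx)]] : near T (1 * r)%N (anc r N j.+1 y) y.
        by apply: contrapT => nn; apply: ndj; right.
      rewrite Wx size_anc // mul1n -/L mulSn.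
      case: dj => [j0|[jL _]].
        by move: szg; rewrite j0 anc0 addn0 => <-; lia.
      by move: szg; rewrite size_anc // -/L; lia.
    by split; [apply: cyN | exists j; split=> //; left].
  have [t tN [dt ndt]] := deep_layer dj ndN.
  exists (skip t (cc (g j y))) => _.
  have CBg : CB (g j y).
    have jL : j <> 0%N /\ (j * L)%N < size (W y).
      by case: dj => [j0|[jL _]]; [case: ndN; left | split=> // j0; case: ndN; left].
    apply: nearCB => //; have [_ jLs] := jL.
    have : near T (t.+2 * r)%N (anc r N j y) y.
      by apply: contrapT => nn; apply: ndt; right.
    by apply: near_leq; rewrite leq_mul2r !ltnS tN orbT.
  split; first by apply: skip_lt; exact: ccN.
  by exists j; split=> //; right; exists t.
exists c, (DC ++ prods (1 :: prods DC F) (prods DY (1 :: prods F DC))).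
split=> [y /cP[]//|i x y xy].
have [[Qx cx] _] := chain_ends xy; have [iN _] := cP _ Qx; rewrite cx in iN.
have [j [dj ndj]] := @deep_max T r N i.+1 x.
pose u := anc r N j x.
have crossing l a b : Q a -> Q b -> c b = i -> a^-1 * b \in ball T r ->
    dp l i.+1 a -> dp l i.+1 b.
  move=> Qa Qb cb ab da; apply: contrapT => ndb.
  have dib : dp l i b := deep_stepS LT sT Qa ab da.
  have [_ [l' [d0 nd1 colb]]] := cP _ Qb.
  have l'E : l' = l.
    apply/eqP; rewrite eqn_leq; apply/andP; split; rewrite leqNgt; apply/negP.
      move=> lt_ll'; apply: ndb; case: l' lt_ll' d0 {nd1 colb} => // l' ll' d0.
      by apply: (deep_anc LT d0); lia.
    rewrite leq_eqVlt => /predU1P[E|lt_l'l].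
      by apply: nd1; rewrite E; exact: dmono dib.
    by apply: nd1; case: l {da ndb} lt_l'l dib => // l l'l dl; apply: (deep_anc LT dl).
  subst l'; rewrite cb in colb; case: colb => [[dN _ _]|[t [tN dt ndt _ iE]]].
    by apply: ndb; exact: dmono dN.
  have [lt_ti|lt_it|ti] := ltngtP t i.
  - by apply: ndt; exact: dmono dib.
  - by apply: ndb; exact: dmono dt.
  - by apply: (@skip_neq t (cc (g l b))); rewrite -iE.
(* The region that a chain of colour [i] cannot leave: beyond layer [i] at the cut [u], and not
   beyond layer [i] at the next cuts. *)
pose R z := [/\ dp j i.+1 z, ~ dp j.+1 i.+1 z & anc r N j z = u].
have Rstep a b : Q a /\ c a = i -> Q b /\ c b = i -> a^-1 * b \in F -> R a -> R b.
  move=> [Qa ca] [Qb cb] /(FT _ _ Qa Qb) ab [da nda ua]; split.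
  - exact: crossing ab da.
  - by move=> db; apply: nda; apply: crossing db => //; exact: ball_sym.
  - by rewrite -ua; apply: (proj1 (deep_step LT sT Qa ab (dmono _ _ _ _ (leq0n _) da))).
pose h z := (e u)^-1 * z.
(* [Q1] is for the core, [Qa] for layers [t > i] at [u], where [skip] keeps the colour, and [Qc] for
   layers [t < i] at the next cuts, where it shifts the colour. *)
pose Q1 z := (Q (h z) /\ size (W (h z)) <= L + r) /\ cy (h z) = i.
pose Qa z := [/\ Q z, R z, CB (h z) & cc (h z) = i].
pose Qc z := [/\ Q z, dp j.+1 0 z, CB (g j.+1 z) & (cc (g j.+1 z)).+1 = i].
apply: (@bounded_sub _ F F _ (fun z => Q1 z \/ (Qa z \/ Qc z))) (chain_inv Rstep xy _) => //.
  move=> z [[Qz cz] [dz ndz uz]]; have [Qg _] := WG j z Qz.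
  have gh : g j z = h z by rewrite /g uz.
  have [_ [j' [d0 nd1 colz]]] := cP _ Qz; rewrite cz in colz.
  have jj' : j <= j'.
    rewrite leqNgt; apply/negP; rewrite leq_eqVlt => /predU1P[E|lt_j'j].
      by apply: nd1; rewrite E; exact: dmono dz.
    by apply: nd1; case: (j) lt_j'j dz => // l l'l dl; apply: (deep_anc LT dl).
  have j'j : j' <= j.+1.
    rewrite leqNgt; apply/negP; case: j' d0 {nd1 colz jj'} => // j' d0 lt_jj'.
    by apply: ndz; apply: (deep_anc LT d0); lia.
  have [E|j'E] := eqVneq j' j.
    subst j'; case: colz => [[_ sz iE]|[t [tN dt ndt CBz iE]]].
      by left; rewrite /Q1 -gh.
    right; left; split=> //; first by rewrite -gh.
    rewrite -gh; move: iE; rewrite /skip; case: ltnP => // le_t iE.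
    case: ndt; apply: dmono dz; lia.
  have E : j' = j.+1 by apply/eqP; rewrite eqn_leq j'j ltn_neqAle eq_sym j'E.
  subst j'; case: colz => [[dN _ _]|[t [tN dt ndt CBz iE]]].
    by case: ndz; exact: dmono dN.
  right; right; split=> //; move: iE; rewrite /skip; case: ltnP => // lt_t iE.
  by case: ndz; apply: dmono dt; lia.
have sz_a z : Qa z -> size (W z) <= (j * L)%N + (N.+2 * r)%N.
  move=> [Qz [_ _ uz] [x' [Qx' Wx'] x'z] _]; have [_ ->] := WG j z Qz.
  rewrite addnC leq_add //; first by rewrite size_drop; lia.
  by have := size_step LT Qx' x'z; rewrite Wx' /g uz.
have sz_c z : Qc z -> (j.+1 * L)%N < size (W z) by case=> [_ [//|[]]].
(* By the choice of [L], no step joins collars of consecutive depths. *)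
have no_ac a b : Qa a -> Qc b -> Q a -> a^-1 * b \in ball T r -> False.
  move=> /sz_a sa /sz_c sb Qa' /(size_step LT Qa'); apply/negP; rewrite -ltnNge.
  apply: leq_trans sb; rewrite ltnS mulSn addnC; apply: leq_trans (leq_add (leqnn r) sa) _.
  rewrite /L; nia.
apply: (@bounded_union _ F FR).
- move=> a b ab; have [[qa|qc] _] := chain_ends ab.
    rewrite -(shift_div u); apply: (bC i).
    apply: chain_map (chain_inv (R := Qa) _ ab qa).
    + by move=> z [_ [_ _ CBz cz]]; split.
    + by move=> z w _ _; rewrite shift_div.
    + move=> z w _ qw zw qz; case: qw => [//|qc].
      case: (qz) (qc) => Qz _ _ _ [Qw _ _ _].
      by case: (no_ac _ _ qz qc Qz (FT _ _ Qz Qw zw)).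
  (* The next cut edge is constant along a chain in [Qc]; below, [i.-1] undoes the shift made by
     [skip]. *)
  pose R' z := Qc z /\ anc r N j.+1 z = anc r N j.+1 a.
  rewrite -(shift_div (anc r N j.+1 a)); apply: (bC i.-1).
  apply: chain_map (chain_inv (R := R') _ ab (conj qc erefl)).
  + by move=> z [_ [[_ _ CBz <-] <-]].
  + by move=> z w _ _; rewrite shift_div.
  + move=> z w _ qw zw [qz zE]; case: qw => [qa|qw].
      case: (qz) (qa) => Qz _ _ _ [Qw _ _ _].
      by case: (no_ac _ _ qa qz Qw (ball_sym sT (FT _ _ Qz Qw zw))).
    case: (qz) (qw) => Qz dz _ _ [Qw _ _ _]; split=> //.
    by rewrite -zE; apply: (proj1 (deep_step LT sT Qz (FT _ _ Qz Qw zw) dz)).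
- move=> a b ab; rewrite -(shift_div u); apply: (bY i); apply: chain_map ab => //.
  by move=> z w _ _; rewrite shift_div.
- by move=> f fF; rewrite mem_cat fF.
- by move=> f fF; rewrite mem_cat fF orbT.
Qed.
End Amalgam.

(** * Graph products and their normal forms *)

Section Permutations.
Local Open Scope group_scope.

(** Actions of [P] are obtained by applying its universal property to this group. *)
Record perm (T : Type) := Perm {
  pfun : T -> T; pinv : T -> T; pfunK : cancel pfun pinv; pinvK : cancel pinv pfun }.

Lemma perm_eq (T : Type) (s t : perm T) : (forall x, pfun s x = pfun t x) -> s = t.
Proof.
case: s t => [f f' fK f'K] [g g' gK g'K] /= /funext fg; subst g.
have E : f' = g' by apply/funext => x; rewrite -{1}[x]g'K fK.
by subst g'; congr Perm; exact: Prop_irrelevance.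
Qed.

Section Group_of_permutations.
Variable T : Type.
HB.instance Definition _ := gen_eqMixin (perm T).
HB.instance Definition _ := gen_choiceMixin (perm T).

Definition perm_one : perm T := @Perm T id id (fun _ => erefl) (fun _ => erefl).
Definition perm_inv (s : perm T) : perm T := Perm (@pinvK T s) (@pfunK T s).
(** [s] is applied first, so that right actions are homomorphisms. *)
Definition perm_mul (s t : perm T) : perm T :=
  Perm (can_comp (@pfunK T t) (@pfunK T s)) (can_comp (@pinvK T s) (@pinvK T t)).

Lemma perm_mulA : associative perm_mul. Proof. by move=> s t u; exact: perm_eq. Qed.
Lemma perm_mul1 : left_id perm_one perm_mul. Proof. by move=> s; exact: perm_eq. Qed.
Lemma perm_mulr1 : right_id perm_one perm_mul. Proof. by move=> s; exact: perm_eq. Qed.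
Lemma perm_mulV : left_inverse perm_one perm_inv perm_mul.
Proof. by move=> s; apply: perm_eq => x /=; rewrite pinvK. Qed.
Lemma perm_mulrV : right_inverse perm_one perm_inv perm_mul.
Proof. by move=> s; apply: perm_eq => x /=; rewrite pfunK. Qed.

HB.instance Definition _ :=
  isGroup.Build (perm T) perm_mulA perm_mul1 perm_mulr1 perm_mulV perm_mulrV.
End Group_of_permutations.

Section Action.
Variables (G : groupType) (T : Type) (act : T -> G -> T).
Hypothesis act1 : forall x, act x 1 = x.
Hypothesis actM : forall x g h, act x (g * h) = act (act x g) h.

Lemma actK g : cancel (act^~ g) (act^~ g^-1).
Proof. by move=> x; rewrite -actM mulgV. Qed.

Lemma actVK g : cancel (act^~ g^-1) (act^~ g).
Proof. by move=> x; rewrite -actM mulVg. Qed.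

Definition act_perm g : perm T := Perm (actK g) (actVK g).

Lemma act_perm_hom : is_hom act_perm.
Proof. by move=> g h; apply: perm_eq => x /=; rewrite actM. Qed.

End Action.
End Permutations.

Section Homs.
Local Open Scope group_scope.
Variables (G H : groupType) (f : G -> H).
Hypothesis hom_f : is_hom f.

Lemma hom1 : f 1 = 1.
Proof. by apply: (mulgI (f 1)); rewrite -hom_f !mulg1. Qed.

Lemma homV x : f x^-1 = (f x)^-1.
Proof. by apply: (mulgI (f x)); rewrite -hom_f !mulgV hom1. Qed.

End Homs.

Section Graph_product.
Local Open Scope group_scope.
Variables (V : eqType) (E : rel V) (G : V -> groupType) (P : groupType).
Variable iota : forall v, G v -> P.
Hypothesis gp : is_graph_product E iota.

Lemma iota_hom v : is_hom (@iota v). Proof. by case: gp. Qed.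

Lemma iota_comm v w g h : E v w -> @iota v g * @iota w h = iota h * iota g.
Proof. by case: gp => _ + _; apply. Qed.

Lemma hom_ext (H : groupType) (f1 f2 : P -> H) : is_hom f1 -> is_hom f2 ->
  (forall v g, f1 (@iota v g) = f2 (iota g)) -> forall x, f1 x = f2 x.
Proof.
move=> h1 h2 eq12 x; case: gp => _ comm /(_ H (fun v g => f1 (iota g))).
case=> [v g h|v w g h Evw|phi [_ _ uniq]].
- by rewrite (@iota_hom v) h1.
- by rewrite -!h1 comm.
- by rewrite (uniq f1) // (uniq f2).
Qed.

Inductive gen (D : V -> Prop) : P -> Prop :=
| gen1 : gen D 1
| genM v g x : D v -> gen D x -> gen D (@iota v g * x).

Lemma gen_iota (D : V -> Prop) v g : D v -> gen D (@iota v g).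
Proof. by move=> Dv; rewrite -[iota g]mulg1; apply: genM => //; exact: gen1. Qed.

Lemma gen_mul D x y : gen D x -> gen D y -> gen D (x * y).
Proof.
move=> Dx Dy; elim: Dx => [|v g {}x Dv _ IH]; first by rewrite mul1g.
by rewrite -mulgA; exact: genM.
Qed.

Lemma gen_inv D x : gen D x -> gen D x^-1.
Proof.
elim=> [|v g {}x Dv _ IH]; first by rewrite invg1; exact: gen1.
rewrite invgM; apply: gen_mul => //; rewrite -(homV (@iota_hom v)).
exact: gen_iota.
Qed.

Lemma gen_sub (D D' : V -> Prop) x : (forall v, D v -> D' v) -> gen D x -> gen D' x.
Proof.
move=> DD'; elim=> [|v g {}x /DD' Dv _ IH]; first exact: gen1.
exact: genM.
Qed.

(* Compare the regular action on [bool * P] with its conjugate by the involution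
   swapping [(true, p)] and [(false, p)] for [p] outside [gen predT]: the vertex
   groups act in the same way, hence so does all of [P]. *)
Lemma gen_all x : gen (fun=> True) x.
Proof.
pose act (z : bool * P) p := (z.1, z.2 * p).
pose t p := `[< gen (fun=> True) p >].
pose act' (z : bool * P) p := (z.1 (+) t z.2 (+) t (z.2 * p), z.2 * p).
have a1 z : act z 1 = z by case: z => b p; rewrite /act mulg1.
have aM z p q : act z (p * q) = act (act z p) q by rewrite /act mulgA.
have a1' z : act' z 1 = z by case: z => b p; rewrite /act' /= mulg1 addbK.
have aM' z p q : act' z (p * q) = act' (act' z p) q.
  by rewrite /act' /= mulgA addbK.
have same v g : act_perm a1 aM (@iota v g) = act_perm a1' aM' (iota g).
  apply: perm_eq => -[b p] /=; rewrite /act /act' /=; congr pair.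
  have -> : t (p * iota g) = t p; last by rewrite addbK.
  have gg : gen (fun=> True) (@iota v g) by exact: gen_iota.
  apply: asbool_equiv_eq; split=> [/gen_mul/(_ (gen_inv gg))|/gen_mul/(_ gg)//].
  by rewrite mulgK.
have := hom_ext (act_perm_hom a1 aM) (act_perm_hom a1' aM') same x.
move=> /(congr1 (fun s => pfun s (true, 1))) /=; rewrite /act /act' /= mul1g.
have -> : t 1 by apply/asboolP; exact: gen1.
by case tx : (t x) => // _; exact/asboolP.
Qed.

Lemma retraction_subproof (D : pred V) : exists rho : P -> P, is_hom rho /\
  forall v g, rho (@iota v g) = if D v then iota g else 1.
Proof.
case: gp => _ comm /(_ P (fun v g => if D v then iota g else 1)).
case=> [v g h|v w g h Evw|rho [h r _]]; last by exists rho.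
  by case: (D v); rewrite ?mulg1 ?iota_hom.
by case: (D v); case: (D w); rewrite ?mulg1 ?mul1g // comm.
Qed.

Definition retr (D : pred V) : P -> P := projT1 (cid (retraction_subproof D)).

Lemma retr_hom D : is_hom (retr D).
Proof. by rewrite /retr; case: cid => rho []. Qed.

Lemma retr_iota (D : pred V) v g : retr D (@iota v g) = if D v then iota g else 1.
Proof. by rewrite /retr; case: cid => rho []. Qed.

Lemma retr_id (D : pred V) x : gen D x -> retr D x = x.
Proof.
elim=> [|v g {}x Dv _ IH]; first by rewrite (hom1 (retr_hom D)).
by rewrite retr_hom retr_iota Dv IH.
Qed.

Lemma retr_gen (D : pred V) x : gen D (retr D x).
Proof.
elim: (gen_all x) => [|v g {}x _ _ IH].
  by rewrite (hom1 (retr_hom D)); exact: gen1.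
rewrite retr_hom retr_iota; case: ifP => Dv; first exact: genM.
by rewrite mul1g.
Qed.

Lemma retr_kill (D D' : pred V) x : (forall v, D v -> ~~ D' v) ->
  gen D x -> retr D' x = 1.
Proof.
move=> DD'; elim=> [|v g {}x /DD' Dv _ IH]; first by rewrite (hom1 (retr_hom D')).
by rewrite retr_hom retr_iota (negbTE Dv) mul1g.
Qed.

Lemma gen_comm (D D' : V -> Prop) x y : (forall v w, D v -> D' w -> E v w) ->
  gen D x -> gen D' y -> x * y = y * x.
Proof.
move=> DD' Dx Dy; elim: Dx => [|v g {}x Dv _ IH]; first by rewrite mul1g mulg1.
rewrite -mulgA IH !mulgA; congr (_ * _).
elim: {IH} Dy => [|w h {}y Dw _ IHy]; first by rewrite mul1g mulg1.
by rewrite mulgA (iota_comm _ _ (DD' _ _ Dv Dw)) -!mulgA IHy.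
Qed.

(** A loop at [v] would force the elements of [G v] to commute in [P]; irreflexivity excludes
    this. *)
Lemma proj_vertex v : (forall u, ~~ E u u) ->
  exists f : P -> G v, is_hom f /\ forall g, f (iota g) = g.
Proof.
move=> irr; pose f w (g : G w) : G v :=
  if pselect (w = v) is left e then eq_rect w (fun u => G u : Type) g v e else 1.
have fv g : f v g = g.
  by rewrite /f; case: pselect => // e; rewrite (Prop_irrelevance e erefl).
have fne w g : w <> v -> f w g = 1 by rewrite /f; case: pselect.
case: gp => _ _ /(_ (G v) f) [w|w u g h Ewu|phi [h r _]].
- have [->|wv] := pselect (w = v); first by move=> g h; rewrite !fv.
  by move=> g h; rewrite !fne // mulg1.
- have [wv|wv] := pselect (w = v); last by rewrite (fne w) // mulg1 mul1g.
  have [uv|uv] := pselect (u = v); last by rewrite (fne u) // mulg1 mul1g.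
  by case/negP: (irr v); rewrite -{1}wv -uv.
- by exists phi; split=> // g; rewrite r fv.
Qed.

End Graph_product.

(** * Reduced words in two subgroups with trivial intersection *)

Section Words.
Local Open Scope group_scope.
Variables (P : groupType) (K : bool -> P -> Prop).
Hypothesis KM : forall b x y, K b x -> K b y -> K b (x * y).
Hypothesis Kdisj : forall b x, K b x -> K (~~ b) x -> x = 1.

(* [reduced b w]: the syllables of [w] are nontrivial and lie alternately in
   [K b] and in [K (~~ b)]; words are written from right to left. *)
Fixpoint reduced b (w : seq P) : Prop :=
  if w is s :: w' then [/\ s <> 1, K b s & reduced (~~ b) w'] else True.

Definition redword w := exists b, reduced b w.

Fixpoint eval (w : seq P) : P := if w is s :: w' then eval w' * s else 1.

(** Right multiplication by [m] in [K b]: the head syllable is the last factor and absorbs [m] if it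
    lies in [K b]; trivial syllables vanish. *)
Definition wact b (w : seq P) m :=
  let push m w := if m == 1 then w else m :: w in
  if w is s :: w' then
    if `[< K b s >] then push (s * m) w' else push m w
  else push m w.

Lemma wact_push b w m : reduced (~~ b) w -> wact b w m = if m == 1 then w else m :: w.
Proof.
case: w => [//|s w] /= [s1 Ks _]; rewrite /wact ifN //.
by apply/asboolPn => Kb; apply: s1; exact: Kdisj Ks.
Qed.

Lemma wact_mul b s w m : K b s ->
  wact b (s :: w) m = if s * m == 1 then w else s * m :: w.
Proof. by move=> Ks; rewrite /wact ifT //; exact/asboolP. Qed.

Lemma redwordP b w : redword w -> reduced (~~ b) w \/
  exists s w', [/\ w = s :: w', s <> 1, K b s & reduced (~~ b) w'].
Proof.
case=> b'; have [->|b'b] := eqVneq b' b; last first.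
  by have -> : b' = ~~ b; [move: b'b; case: b'; case: b | left].
case: w => [_|s w' [s1 Ks r]]; first by left.
by right; exists s, w'.
Qed.

Lemma redword_push b w m : K b m -> reduced (~~ b) w ->
  redword (if m == 1 then w else m :: w).
Proof.
by move=> Km r; case: eqP => m1; [exists (~~ b) | exists b; split].
Qed.

Lemma wact_red b w m : K b m -> redword w -> redword (wact b w m).
Proof.
move=> Km /(redwordP b)[r|[s [w' [-> _ Ks r]]]].
  by rewrite wact_push //; exact: redword_push Km r.
by rewrite wact_mul //; apply: redword_push r; exact: KM.
Qed.

Lemma wact1 b w : redword w -> wact b w 1 = w.
Proof.
move=> /(redwordP b)[r|[s [w' [-> s1 Ks r]]]]; first by rewrite wact_push // eqxx.
by rewrite wact_mul // mulg1 ifN //; apply/eqP.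
Qed.

Lemma wactM b w m m' : K b m -> redword w ->
  wact b w (m * m') = wact b (wact b w m) m'.
Proof.
move=> Km /(redwordP b)[r|[s [w' [-> s1 Ks r]]]].
  rewrite !(wact_push _ r); case: (m =P 1) => [->|m1].
    by rewrite mul1g wact_push.
  by rewrite wact_mul.
rewrite !(wact_mul _ _ Ks) mulgA; case: (s * m =P 1) => [->|m1].
  by rewrite mul1g wact_push.
by rewrite wact_mul //; exact: KM.
Qed.

Lemma eval_wact b w m : eval (wact b w m) = eval w * m.
Proof.
case: w => [|s w] /=; first by case: eqP => [->|_] /=; rewrite ?mulg1.
case: asboolP => _; last by case: eqP => [->|_] /=; rewrite ?mulg1.
by rewrite -mulgA; case: eqP => [->|_] /=; rewrite ?mulg1.
Qed.

Lemma eval_cat w u : eval (w ++ u) = eval u * eval w.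
Proof. by elim: w => [|s w IH] /=; rewrite ?mulg1 // IH mulgA. Qed.

Lemma wact_shape b w m : K b m -> redword w -> exists u,
  (w = u \/ exists2 s, (K b s /\ s <> 1) & w = s :: u) /\
  (wact b w m = u \/ exists2 s, (K b s /\ s <> 1) & wact b w m = s :: u).
Proof.
move=> Km /(redwordP b)[r|[s [w' [-> s1 Ks r]]]].
  exists w; split; first by left.
  by rewrite wact_push //; case: eqP => m1; [left | right; exists m].
exists w'; split; first by right; exists s.
rewrite wact_mul //; case: eqP => m1; [by left | right; exists (s * m) => //].
by split=> //; exact: KM.
Qed.

Lemma redword_catr w u : redword (w ++ u) -> redword u.
Proof.
elim: w => [//|s w IH] [b /= [_ _ r]]; apply: IH; by exists (~~ b).
Qed.

Lemma redword_catl w u : redword (w ++ u) -> redword w.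
Proof.
case=> b r; exists b; elim: w b r => [//|s w IH] b /= [s1 Ks r].
by split=> //; exact: IH.
Qed.

End Words.

(** * Normal forms after adding one vertex *)

Section Normal_form.
Local Open Scope group_scope.
Variables (V : eqType) (E : rel V) (G : V -> groupType) (P : groupType).
Variable iota : forall v, G v -> P.
Hypothesis simple : simplicial_graph E.
Hypothesis gp : is_graph_product E iota.
Variables (D : seq V) (v : V).
Hypothesis vD : v \notin D.

Let L : pred V := fun w => (w \in D) && E v w.
Let A x := gen iota (fun w => w \in D) x.
Let C x := gen iota L x.
Let rho := retr gp L.
Let Gv x := exists g, x = @iota v g.
(** [A] is the semidirect product of [K true] and [C], and [C] commutes with [Gv]. So the elements
    of [Q] have the form [eval w * c], with [w] alternating between [K true] and [Gv], and [c] in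
    [C]. *)
Let K b x := if b then A x /\ rho x = 1 else Gv x.
Let Q x := gen iota (fun w => w \in v :: D) x.

Lemma retract_hom : is_hom rho. Proof. exact: retr_hom. Qed.
Lemma retract_link x : C (rho x). Proof. exact: retr_gen. Qed.
Lemma retract_id x : C x -> rho x = x. Proof. exact: retr_id. Qed.
Lemma linkA x : C x -> A x. Proof. by apply: gen_sub => w /andP[]. Qed.
Lemma A_Q x : A x -> Q x. Proof. by apply: gen_sub => w; rewrite inE orbC => ->. Qed.
Lemma vertex_Q x : Gv x -> Q x.
Proof. by case=> g ->; apply: gen_iota; exact: mem_head. Qed.

Lemma vertex_link_comm g c : Gv g -> C c -> g * c = c * g.
Proof.
case=> h -> Cc; apply: (gen_comm gp (D := fun w => w = v)) Cc; last exact: gen_iota.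
by move=> u w -> /andP[].
Qed.

Lemma Gv_mul x y : Gv x -> Gv y -> Gv (x * y).
Proof. by move=> [g ->] [h ->]; exists (g * h); rewrite (iota_hom gp). Qed.

Lemma Gv_inv x : Gv x -> Gv x^-1.
Proof. by move=> [g ->]; exists g^-1; rewrite (homV (iota_hom gp (v := v))). Qed.

Lemma K_mul b x y : K b x -> K b y -> K b (x * y).
Proof.
case: b => /=; last exact: Gv_mul.
move=> [Ax rx] [Ay ry]; split; first exact: gen_mul.
by rewrite retract_hom rx ry mulg1.
Qed.

Lemma A_vertex x : A x -> Gv x -> x = 1.
Proof.
move=> Ax [g xg]; rewrite -(retr_kill gp (D := mem D) (D' := pred1 v) _ Ax).
  by rewrite xg retr_iota /= eqxx.
by move=> w wD; apply: contra vD => /eqP <-.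
Qed.

Lemma K_disj b x : K b x -> K (~~ b) x -> x = 1.
Proof. by case: b => /= [[Ax _]|Gx]; [exact: A_vertex|move=> [Ax _]; exact: A_vertex]. Qed.

Lemma K_Q b x : K b x -> Q x.
Proof. by case: b => [[/A_Q]|/vertex_Q]. Qed.

(** Comes from [c * a = conjpart c a * (c * rho a)]: a syllable in [K true] followed by the new
    element of [C]. *)
Definition conjpart c a := c * (a * (rho a)^-1) * c^-1.

Lemma K_conjpart c a : C c -> A a -> K true (conjpart c a).
Proof.
move=> Cc Aa; split.
  have CV x : C x -> A x^-1 by move=> Cx; apply: (gen_inv gp); exact: linkA.
  apply: gen_mul (CV _ Cc); apply: gen_mul; first exact: linkA.
  exact: gen_mul Aa (CV _ (retract_link a)).
have h := retract_hom; rewrite /conjpart !h !(homV h) (retract_id (retract_link a)).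
by rewrite mulgV mulg1 mulgV.
Qed.

(** The cocycle identity that makes [actA] an action. *)
Lemma conjpartM c a a' :
  conjpart c (a * a') = conjpart c a * conjpart (c * rho a) a'.
Proof.
by rewrite /conjpart retract_hom !invgM !mulgA !mulgVK.
Qed.

Lemma conjpart_link c a : C a -> conjpart c a = 1.
Proof. by move=> /retract_id; rewrite /conjpart => ->; rewrite mulgV mulg1 mulgV. Qed.

(* The action of [A] and [G_v] on pairs (word, element of [C]), which mimics right
   multiplication by an element of [P] on [eval w * c]. *)
Definition valid (z : seq P * P) := redword K z.1 /\ C z.2.
Definition actA (z : seq P * P) a := (wact K true z.1 (conjpart z.2 a), z.2 * rho a).
Definition actG (z : seq P * P) g := (wact K false z.1 g, z.2).
Definition value (z : seq P * P) := eval z.1 * z.2.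

Lemma validA z a : A a -> valid z -> valid (actA z a).
Proof.
move=> Aa [r Cc]; split=> /=.
  by apply: wact_red => //; [exact: K_mul | exact: K_disj | exact: K_conjpart].
by apply: gen_mul => //; exact: retract_link.
Qed.

Lemma validG z g : Gv g -> valid z -> valid (actG z g).
Proof.
move=> Gg [r Cc]; split=> //=.
by apply: wact_red => //; [exact: K_mul | exact: K_disj].
Qed.

Lemma actAM z a a' : A a -> valid z -> actA z (a * a') = actA (actA z a) a'.
Proof.
move=> Aa [r Cc]; rewrite /actA /= conjpartM retract_hom.
by rewrite (wactM K_mul K_disj _ (K_conjpart Cc Aa) r) mulgA.
Qed.

Lemma actGM z g g' : Gv g -> valid z -> actG z (g * g') = actG (actG z g) g'.
Proof.
by move=> Gg [r Cc]; rewrite /actG /= wactM //; [exact: K_mul | exact: K_disj].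
Qed.

Lemma actA_link z c : C c -> valid z -> actA z c = (z.1, z.2 * c).
Proof.
move=> Cc [r _]; rewrite /actA conjpart_link // retract_id // wact1 //.
exact: K_disj.
Qed.

Lemma actG1 z : valid z -> actG z 1 = z.
Proof. by case: z => w c [r _]; rewrite /actG wact1 //; exact: K_disj. Qed.

Lemma value_actA z a : value (actA z a) = value z * a.
Proof.
by rewrite /value /= eval_wact /conjpart !mulgA !mulgVK.
Qed.

Lemma value_actG z g : Gv g -> valid z -> value (actG z g) = value z * g.
Proof.
move=> Gg [_ Cc]; rewrite /value /= eval_wact -!mulgA; congr (_ * _).
exact: vertex_link_comm.
Qed.

(** Fixing the invalid pairs makes the action total, hence an action by permutations. *)
Definition vact w (z : seq P * P) (g : G w) :=
  if `[< valid z >] then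
    if w \in D then actA z (iota g) else if w == v then actG z (iota g) else z
  else z.

Lemma iotaA w (g : G w) : w \in D -> A (iota g).
Proof. by move=> wD; exact: gen_iota. Qed.

Lemma iotaG w (g : G w) : w == v -> Gv (iota g).
Proof. by move=> /eqP wv; subst w; exists g. Qed.

Lemma vact_valid w z (g : G w) : valid z -> valid (vact z g).
Proof.
move=> vz; rewrite /vact; case: asboolP => // _.
case: ifP => [wD|_]; first by apply: validA => //; exact: iotaA.
by case: ifP => // wv; apply: validG => //; exact: iotaG.
Qed.

Lemma vactE w z (g : G w) : valid z -> vact z g =
  if w \in D then actA z (iota g) else if w == v then actG z (iota g) else z.
Proof. by move=> vz; rewrite /vact ifT //; exact/asboolP. Qed.

Lemma vact_invalid w z (g : G w) : ~ valid z -> vact z g = z.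
Proof. by move=> vz; rewrite /vact ifN //; exact/asboolPn. Qed.

Lemma C1 : C 1. Proof. exact: gen1. Qed.

Lemma vact1 w z : vact z (1 : G w) = z.
Proof.
have [vz|/vact_invalid//] := pselect (valid z).
rewrite vactE // (hom1 (iota_hom gp (v := w))) actA_link //; last exact: C1.
by rewrite mulg1 actG1 // -surjective_pairing !if_same.
Qed.

Lemma vactM w z (g h : G w) : vact z (g * h) = vact (vact z g) h.
Proof.
have [vz|vz] := pselect (valid z); last by rewrite !vact_invalid.
rewrite (vactE _ (vact_valid g vz)) !vactE // (iota_hom gp).
case: ifP => [wD|_]; first by apply: actAM => //; exact: iotaA.
by case: ifP => // wv; apply: actGM => //; exact: iotaG.
Qed.

Lemma actAG_comm z a g : C a -> Gv g -> valid z ->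
  actG (actA z a) g = actA (actG z g) a.
Proof.
move=> Ca Gg vz; rewrite !actA_link //; exact: validG.
Qed.

(** Two vertices of [D] commute already inside [A]; a neighbour of [v] lies in the link and acts
    only on the component in [C], which [actG] leaves alone. *)
Lemma vact_comm u w z (g : G u) (h : G w) : E u w ->
  vact (vact z g) h = vact (vact z h) g.
Proof.
have [sE irrE] := simple.
move=> Euw; have [vz|vz] := pselect (valid z); last by rewrite !vact_invalid.
rewrite (vactE _ (vact_valid g vz)) (vactE _ (vact_valid h vz)) !vactE //.
have [uD|uD] := boolP (u \in D); have [wD|wD] := boolP (w \in D) => //.
- rewrite -!actAM //; try exact: iotaA.
  by rewrite (iota_comm gp).
- case: ifP => // wv; apply: actAG_comm => //; last exact: iotaG.
  by apply: gen_iota; rewrite /L uD sE -(eqP wv).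
- case: ifP => // uv; symmetry; apply: actAG_comm => //; last exact: iotaG.
  by apply: gen_iota; rewrite /L wD -(eqP uv).
- have [/eqP uv|//] := ifP; case: ifP => // /eqP wv.
  by case/negP: (irrE v); rewrite -{1}wv -uv.
Qed.

Lemma normal_form_action : exists phi : P -> perm (seq P * P),
  is_hom phi /\ forall w (g : G w) z, pfun (phi (iota g)) z = vact z g.
Proof.
case: gp => _ _ /(_ _ (fun w => act_perm (@vact1 w) (@vactM w))).
case=> [w|u w g h Euw|phi [hphi phiE _]]; first exact: act_perm_hom.
  by apply: perm_eq => z /=; exact: vact_comm.
by exists phi; split=> // w g z; rewrite phiE.
Qed.

Let phi : P -> perm (seq P * P) := projT1 (cid normal_form_action).

Lemma phi_hom : is_hom phi.
Proof. by rewrite /phi; case: cid => f []. Qed.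

Lemma phi_iota w (g : G w) z : pfun (phi (iota g)) z = vact z g.
Proof. by rewrite /phi; case: cid => f []. Qed.

Lemma phiM x y z : pfun (phi (x * y)) z = pfun (phi y) (pfun (phi x) z).
Proof. by rewrite phi_hom. Qed.

Lemma phi1 z : pfun (phi 1) z = z.
Proof. by rewrite (hom1 phi_hom). Qed.

Lemma phi_A a z : A a -> valid z -> pfun (phi a) z = actA z a.
Proof.
move=> Aa; elim: Aa z => {a} [|w g a wD Aa IH] z vz.
  by rewrite phi1 actA_link ?mulg1 -?surjective_pairing //; exact: C1.
have Ag := iotaA g wD.
by rewrite phiM phi_iota vactE // wD IH ?actAM //; exact: validA.
Qed.

Lemma phi_G g z : Gv g -> valid z -> pfun (phi g) z = actG z g.
Proof.
by case=> h -> vz; rewrite phi_iota vactE // (negbTE vD) eqxx.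
Qed.

Lemma phi_Q q z : Q q -> valid z ->
  valid (pfun (phi q) z) /\ value (pfun (phi q) z) = value z * q.
Proof.
move=> Qq; elim: Qq z => {q} [|w g q wD Qq IH] z vz; first by rewrite phi1 mulg1.
rewrite phiM phi_iota mulgA.
have [vz' ->] := IH _ (vact_valid g vz); split=> //; congr (_ * q).
rewrite vactE //; case: ifP => [_|w'D]; first exact: value_actA.
move: wD; rewrite inE w'D orbF => wv; rewrite wv.
by apply: value_actG => //; exact: iotaG.
Qed.

Definition nf x := pfun (phi x) ([::], 1).
Definition word x := (nf x).1.

Lemma valid0 : valid ([::], 1).
Proof. by split; [exists true | exact: C1]. Qed.

Lemma nfM x y : nf (x * y) = pfun (phi y) (nf x).
Proof. exact: phiM. Qed.

Lemma nfP x : Q x -> valid (nf x) /\ value (nf x) = x.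
Proof. by move=> /phi_Q/(_ valid0)[vx ->]; rewrite /value /= !mul1g. Qed.

Lemma nf_eval w : redword K w -> nf (eval w) = (w, 1).
Proof.
case=> b; elim: w b => [|s w IH] b /=; first by rewrite /nf phi1.
move=> [s1 Ks r]; have vw : valid (w, 1) by split; [exists (~~ b) | exact: C1].
rewrite nfM (IH _ r); have wE := wact_push K_disj s r.
case: b Ks r wE => [[As rs]|Gs] r wE.
  rewrite phi_A // /actA /= rs mulg1 /conjpart rs invg1 !mulg1 mul1g wE.
  by rewrite ifN //; exact/eqP.
by rewrite phi_G // /actG /= wE ifN //; exact/eqP.
Qed.

(** Uniqueness of normal forms: words can be read off from any factorization of the right shape. *)
Lemma nf_value z : valid z -> nf (value z) = z.
Proof.
case: z => w c vz; have [r Cc] := vz.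
have vw : valid (w, 1) by split=> //; exact: C1.
by rewrite /value nfM nf_eval // phi_A ?actA_link //= ?mul1g //; exact: linkA.
Qed.

Lemma eval_Q w : redword K w -> Q (eval w).
Proof.
case=> b; elim: w b => [|s w IH] b /=; first by move=> _; exact: gen1.
by move=> [_ /K_Q Qs /IH Qw]; exact: gen_mul.
Qed.

(** The two vertex groups of the tree; both contain the edge group [C]. *)
Let M b x := if b then A x else exists g c, [/\ Gv g, C c & x = g * c].
Let ty x := `[< A x >].

Lemma K_ty b s : K b s -> s <> 1 -> ty s = b.
Proof.
case: b => [[As _] _|Gs s1]; first exact/asboolP.
by apply/asboolPn => As; apply: s1; exact: A_vertex.
Qed.

Lemma M_Q b x : M b x -> Q x.
Proof.
case: b => [|[g [c [/vertex_Q Qg /linkA/A_Q Qc ->]]]]; first exact: A_Q.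
exact: gen_mul.
Qed.

Lemma M_inv b x : M b x -> M b x^-1.
Proof.
case: b => [|[g [c [Gg Cc ->]]]]; first exact: (gen_inv gp).
have Cc' : C c^-1 by exact: (gen_inv gp).
exists g^-1, c^-1; split=> //; first exact: Gv_inv.
by rewrite invgM vertex_link_comm //; exact: Gv_inv.
Qed.

Lemma Q_letters f : Q f -> exists ts : seq P,
  (forall t, t \in ts -> exists b, M b t) /\ f = foldr (fun a b => a * b) 1 ts.
Proof.
elim=> [|w g x wD _ [ts [Mts ->]]]; first by exists [::].
exists (iota g :: ts); split=> // t; rewrite inE => /orP[/eqP->|/Mts//].
move: wD; rewrite inE => /orP[wv|wD]; last by exists true; exact: iotaA.
by exists false, (iota g), 1; split; rewrite ?mulg1 //; [exact: iotaG | exact: C1].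
Qed.

Lemma word_step y b t : Q y -> M b t -> exists u,
  (word y = u \/ exists2 s, ty s = b & word y = s :: u) /\
  (word (y * t) = u \/ exists2 s, ty s = b & word (y * t) = s :: u).
Proof.
move=> Qy Mt; have [vy _] := nfP Qy; have [ry Cy] := vy.
(* A factor in [C] changes only the second component, so [t] acts on the word through an element of
   [K b]. *)
have [m Km ->] : exists2 m, K b m & word (y * t) = wact K b (word y) m.
  rewrite /word nfM; case: b Mt => [At|[g [c [Gg Cc ->]]]].
    by rewrite phi_A //; eexists; first exact: K_conjpart Cy At.
  exists g => //; have vg := validG Gg vy.
  by rewrite phiM (phi_G Gg vy) phi_A ?actA_link //; exact: linkA.
have [u [yu wu]] := wact_shape K_mul K_disj Km (ry : redword K (word y)).
exists u; split.
  by case: yu => [|[s [Ks s1] ->]]; [left | right; exists s => //; exact: K_ty].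
by case: wu => [|[s [Ks s1] ->]]; [left | right; exists s => //; exact: K_ty].
Qed.

Lemma word_cat y w u : Q y -> word y = w ++ u ->
  Q (eval u) /\ word ((eval u)^-1 * y) = w.
Proof.
move=> Qy wu; have [[ry Cy] vy] := nfP Qy; rewrite -/(word y) wu in ry.
split; first by apply: eval_Q; exact: redword_catr ry.
rewrite -vy /value -/(word y) wu eval_cat -!mulgA mulKg.
rewrite -/(value (w, (nf y).2)) /word nf_value //.
by split=> //=; exact: redword_catl ry.
Qed.

Lemma word_seq1 y s : Q y -> word y = [:: s] -> M (ty s) y.
Proof.
move=> Qy ws; have [[ry Cy] vy] := nfP Qy; rewrite -/(word y) ws in ry.
have yE : y = s * (nf y).2 by rewrite -{1}vy /value -/(word y) ws /= mul1g.
case: ry => b [s1 Ks _]; rewrite (K_ty Ks s1) yE.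
case: b Ks => [[As _]|Gs]; first by apply: gen_mul => //; exact: linkA.
by exists s, (nf y).2.
Qed.

Lemma word_nil x : Q x -> word x = [::] -> C x.
Proof.
move=> Qx wx; have [[_ Cx] <-] := nfP Qx.
by rewrite /value -/(word x) wx /= mul1g.
Qed.

Theorem colorable_vertex N :
  colorable N.+1 A -> colorable N.+1 (M false) -> colorable N C ->
  colorable N.+1 Q.
Proof.
move=> cA cB cC; apply: (colorable_amalgam (M := M) (W := word) (ty := ty) (e := @eval P)).
- exact: gen_mul.
- exact: (gen_inv gp).
- exact: M_Q.
- exact: M_inv.
- exact: Q_letters.
- exact: word_step.
- exact: word_cat.
- exact: word_seq1.
- by case.
- by apply: colorable_sub cC => x [Qx wx]; exact: word_nil.
Qed.

(** [M false] is the direct product of [Gv] and [C], with the two retractions as coordinates. *)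
Lemma colorable_star n m : colorable n.+1 Gv -> colorable m.+1 C ->
  colorable (n + m).+1 (M false).
Proof.
pose p := retr gp (pred1 v).
have hp : is_hom p by exact: retr_hom.
have pG g : Gv g -> p g = g by case=> h ->; rewrite /p retr_iota /= eqxx.
have pC c : C c -> p c = 1.
  move=> /linkA Ac; apply: retr_kill Ac => w wD.
  by apply: contra vD => /eqP <-.
have rG g : Gv g -> rho g = 1.
  by case=> h ->; rewrite /rho retr_iota /L (negbTE vD).
apply: (colorable_prod hp retract_hom).
- by move=> x [g [c [Gg Cc ->]]]; rewrite hp (pG _ Gg) (pC _ Cc) mulg1.
- by move=> x _; exact: retract_link.
move=> D1 D2; exists (prods D1 D2) => x y [g [c [Gg Cc ->]]] [g' [c' [Gg' Cc' ->]]].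
rewrite !hp !retract_hom (pG _ Gg) (pG _ Gg') (pC _ Cc) (pC _ Cc') (rG _ Gg) (rG _ Gg').
rewrite (retract_id Cc) (retract_id Cc') !mulg1 !mul1g => gD cD.
have Gh : Gv (g^-1 * g') by apply: Gv_mul => //; exact: Gv_inv.
have Cc'' : C c^-1 by exact: (gen_inv gp).
rewrite invgM -!mulgA (mulgA g^-1) (mulgA c^-1) -(vertex_link_comm Gh Cc'') -mulgA.
exact: mem_prods.
Qed.

End Normal_form.

(** * Metrics *)

Section Metrics.
Local Open Scope group_scope.

Lemma word_len_le_wordlen (H : groupType) (S : seq H) g :
  generates S -> word_len_le S g (wordlen S g).
Proof.
move=> gS; rewrite /wordlen; case: pselect => [h|]; last by case; exact: gS.
by case: ex_minnP => m /asboolP.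
Qed.

Lemma word_len_le_ball (H : groupType) (S : seq H) g m :
  word_len_le S g m -> g \in ball (S ++ [seq s^-1 | s <- S]) m.
Proof.
case=> w [wm /allP wS <-]; apply: ball_leq wm _ _; apply: mem_ball_foldr => s /wS.
rewrite mem_cat => /orP[->//|sS]; apply/orP; right.
by rewrite -[s]invgK map_f.
Qed.

(** At a scale above all word lengths in [F], a chain of constant colour stays in one member of the
    cover; bounded word length means lying in a finite ball. *)
Lemma colorable_word_metric (H : groupType) (S : seq H) n :
  generates S -> asdim_le (word_metric S) n -> colorable n.+1 (fun _ : H => True).
Proof.
move=> gS dimS F; pose r := \max_(f <- F) wordlen S f.
have r0 : (0 < r.+1%:R :> Real)%R by rewrite ltr0Sn.
have [U [cover bnd disj]] := dimS _ r0.
have /choice[c cP] x : exists iA : 'I_n.+1 * (H -> Prop), U iA.1 iA.2 /\ iA.2 x.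
  by have [i [A [UA Ax]]] := cover x; exists (i, A).
have /choice[m mP] (i : 'I_n.+1) : exists m : nat, forall A, U i A ->
    forall x y, A x -> A y -> (wordlen S (x^-1 * y) <= m)%N.
  have [D DP] := bnd i; exists (Num.bound `|D|%R) => A UA x y Ax Ay.
  rewrite -(ler_nat Real); apply: le_trans (DP _ UA _ _ Ax Ay) _.
  exact: le_trans (ler_norm _) (ltW (archi_boundP (normr_ge0 _))).
exists (fun x => val (c x).1), (ball (S ++ [seq s^-1 | s <- S]) (\max_i m i)).
split=> [x _|i x y xy]; first exact: ltn_ord.
have inv a b : True /\ val (c a).1 = i -> True /\ val (c b).1 = i ->
    a^-1 * b \in F -> (c x).2 a -> (c x).2 b.
  move=> [_ ca] [_ cb] ab Aa; have [[_ cx] _] := chain_ends xy.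
  have [Ux _] := cP x; have [Ub Bb] := cP b.
  have cbx : (c b).1 = (c x).1 by apply: val_inj; rewrite cb cx.
  rewrite cbx in Ub; have [<-//|AB] := pselect ((c b).2 = (c x).2).
  have /(_ _ _ Aa Bb) := disj _ _ _ Ux Ub (fun e => AB (esym e)).
  rewrite /word_metric ltr_nat ltnNge => /negP[]; apply: leqW.
  exact: (leq_bigmax_seq (F := wordlen S) _ ab isT).
have [Ux Ax] := cP x.
have [_ [_ Ay]] := chain_ends (chain_inv inv xy Ax).
apply: (ball_leq (leq_bigmax (c x).1)).
apply: (@ball_leq _ _ (wordlen S (x^-1 * y))); first exact: mP Ux _ _ Ax Ay.
by apply: word_len_le_ball; exact: word_len_le_wordlen.
Qed.

(* A finite set only moves points within cosets of the subgroup it generates. *)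
Lemma colorable_cosets (P : groupType) m :
  (forall F : seq P, exists H : P -> Prop, [/\ H 1, forall x y, H x -> H y -> H (x * y),
     forall x, H x -> H x^-1, forall f, f \in F -> H f & colorable m H]) ->
  colorable m (fun _ : P => True).
Proof.
move=> HP F; have [H [H1 HM HV HF cH]] := HP F; have [c [D [cm bD]]] := cH F.
(* The choice depends on the set alone, so all points of a coset get the same representative. *)
have /choice[r rP] (A : P -> Prop) : exists a, (exists z, A z) -> A a.
  have [[z Az]|] := pselect (exists z, A z); first by exists z.
  by exists 1.
pose rep x := r (fun z => H (z^-1 * x)).
have repH x : H ((rep x)^-1 * x).
  by apply: (rP (fun z => H (z^-1 * x))); exists x; rewrite mulVg.
have rep_eq x y : H (x^-1 * y) -> rep x = rep y.
  move=> Hxy; congr r; apply/funext => z; apply/propext; split=> Hz.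
    by rewrite (divgM z x y); exact: HM.
  by rewrite (divgM z y x); apply: HM => //; rewrite -invdivg; exact: HV.
exists (fun x => c ((rep x)^-1 * x)), D; split=> [x _|i x y xy]; first exact: cm.
rewrite -(divgMl (rep x)^-1); apply: (bD i).
have inv a b : True /\ c ((rep a)^-1 * a) = i -> True /\ c ((rep b)^-1 * b) = i ->
    a^-1 * b \in F -> rep a = rep x -> rep b = rep x.
  by move=> _ _ /HF/rep_eq <-.
apply: chain_map (chain_inv inv xy erefl) => [z [[_ cz] <-]|z w _ _].
  by split; [exact: repH | exact: cz].
by rewrite divgMl.
Qed.

(** By properness the ball of radius [r] is a finite [F]; the members of the cover are the [F]-chain
    components of the colours. *)
Lemma asdim_le_colorable (P : groupType) (d : P -> P -> Real) n :
  is_metric d -> left_invariant d -> proper_metric d ->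
  colorable n.+1 (fun _ : P => True) -> asdim_le d n.
Proof.
move=> [d0 _ dC dD] dl dp col r r0.
have dE x y : d x y = d 1 (x^-1 * y) by rewrite -[RHS](dl x) mulg1 mulVKg.
have [F FE] := (finite_seqP _).1 (dp 1 r).
have FP x y : (x^-1 * y \in F) = (d x y <= r)%R.
  by rewrite dE; apply/idP/idP; have := congr1 (fun A => A (x^-1 * y)) FE => /= ->.
have symF z : z \in F -> z^-1 \in F.
  by move: (FP 1 z) (FP z 1); rewrite invg1 mul1g mulg1 dC => -> ->.
have [c [D [cn bD]]] := col F.
pose Y i z := True /\ c z = i.
have [B BP] : exists B : Real, forall f, f \in D -> (d 1%g f <= B)%R.
  elim: (D) => [|f s [B BP]]; first by exists 0%R.
  exists (Num.max (d 1 f) B) => g; rewrite inE le_max.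
  by case/predU1P=> [->|/BP->]; rewrite ?lexx ?orbT.
exists (fun i A => exists2 x, c x = i & A = chain F (Y i) x); split.
- move=> x; exists (Ordinal (cn x I)), (chain F (Y (c x)) x).
  by split; [exists x | constructor].
- move=> i; exists (B + B)%R => _ [z zi ->] x y zx zy.
  apply: le_trans (dD x z y) _; apply: lerD.
    by rewrite dC dE; apply: BP; exact: bD zx.
  by rewrite dE; apply: BP; exact: bD zy.
- move=> i _ _ [a ai ->] [b bi ->] AB x y ax by_.
  rewrite ltNge -FP; apply/negP => xy; apply: AB.
  have [_ Yx] := chain_ends ax.
  have ab := chain_trans ax (chain_cons Yx xy (chain_sym symF by_)).
  apply/funext => z; apply/propext; split; last exact: chain_trans ab.
  exact: chain_trans (chain_sym symF ab).
Qed.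
End Metrics.

(** * Induction over finite sets of vertices *)

Section Graph_products.
Local Open Scope group_scope.
Variables (V : eqType) (E : rel V) (G : V -> groupType) (P : groupType).
Variable iota : forall v, G v -> P.
Hypothesis simple : simplicial_graph E.
Hypothesis gp : is_graph_product E iota.
Variable n : nat.
Hypothesis n_gt0 : 0 < n.
Hypothesis vertex_dim : forall v, colorable n.+1 (fun _ : G v => True).

Lemma colorable_vertex_group v : colorable n.+1 (fun x : P => exists g, x = @iota v g).
Proof.
have [f [hf fK]] := proj_vertex gp v simple.2.
have fV x y : (f x)^-1 * f y = f (x^-1 * y) by rewrite hf (homV hf).
apply: (colorable_coarse (f := f)) (@vertex_dim v) => // [F|D'].
  by exists [seq f x | x <- F] => x y _ _ xy; rewrite fV map_f.
exists [seq @iota v g | g <- D'] => x y [g ->] [h ->]; rewrite !fK => gh.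
by rewrite -(homV (iota_hom gp (v := v))) -(iota_hom gp) map_f.
Qed.

Lemma colorable_subgraph (D : seq V) j :
  (forall s, is_clique E s -> {subset s <= D} -> size s <= j) ->
  colorable (n * j).+1 (gen iota (fun w => w \in D)).
Proof.
have [m] := ubnP (size D); elim: m D j => // m IH [|v D] j /= szD clq.
  move=> F; exists (fun=> 0%N), [:: 1]; split=> // i x y xy.
  have [[Qx _] [Qy _]] := chain_ends xy.
  have triv z : gen iota (fun w => w \in [::]) z -> z = 1 by case.
  by rewrite (triv _ Qx) (triv _ Qy) mulVg mem_head.
have [vD|vD] := boolP (v \in D).
  apply: (@colorable_sub _ _ _ (gen iota (fun w => w \in D))) => [x|].
    by apply: gen_sub => w; rewrite inE => /predU1P[->|].
  apply: IH => // s cs sD; apply: clq => // w /sD wD; by rewrite inE wD orbT.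
have j_gt0 : 0 < j.
  apply: (clq [:: v]); first by split=> // x y; rewrite !inE => /eqP-> /eqP->; rewrite eqxx.
  by move=> w; rewrite !inE => ->.
(* A clique in the link extends by [v], so it has at most [j.-1] vertices. *)
have colC : colorable (n * j.-1).+1 (gen iota (fun w => (w \in D) && E v w)).
  pose D' := [seq w <- D | E v w].
  apply: (@colorable_sub _ _ _ (gen iota (fun w => w \in D'))) => [x|].
    by apply: gen_sub => w; rewrite mem_filter andbC.
  apply: IH => [|s [us cs] sD].
    by apply: leq_ltn_trans (szD : size D < m); rewrite size_filter count_size.
  have vs w : w \in s -> w \in D /\ E v w by move=> /sD; rewrite mem_filter => /andP[].
  suff : size (v :: s) <= j by rewrite /= -{1}(prednK j_gt0) ltnS.
  apply: clq => [|w]; last by rewrite !inE => /predU1P[->|/vs[-> _]]; rewrite ?eqxx ?orbT.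
  split; first by rewrite /= us andbT; apply: contra vD => /vs[].
  move=> x y; rewrite !inE => /predU1P[->|xs] /predU1P[->|ys]; first by rewrite eqxx.
  - by case: (vs _ ys).
  - by rewrite simple.1; case: (vs _ xs).
  - exact: cs.
apply: (colorable_vertex simple gp vD).
- by apply: IH => // s cs sD; apply: clq => // w /sD wD; rewrite inE wD orbT.
- have := colorable_star gp vD (colorable_vertex_group v) colC.
  by rewrite -mulnS prednK.
(* Since [n > 0], [n * j.-1 + 1 <= n * j]: the edge group saves the colour that the amalgam step
   requires. *)
- apply: colorable_leq colC; rewrite -[X in _ <= n * X](prednK j_gt0) mulnS.
  by rewrite -add1n leq_add2r.
Qed.

Lemma colorable_graph_product k : clique_number_le E k ->
  colorable (n * k).+1 (fun _ : P => True).
Proof.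
move=> clq; apply: colorable_cosets => F.
have [D DF] : exists D : seq V, forall f, f \in F -> gen iota (fun w => w \in D) f.
  elim: F => [|f F [D DF]]; first by exists [::].
  have [D' D'f] : exists D' : seq V, gen iota (fun w => w \in D') f.
    elim: (gen_all gp f) => [|v g x _ _ [D' D'x]]; first by exists [::]; exact: gen1.
    exists (v :: D'); apply: genM; first exact: mem_head.
    by apply: gen_sub D'x => w wD'; rewrite inE wD' orbT.
  exists (D' ++ D) => z; rewrite inE => /predU1P[->|/DF].
    by apply: gen_sub D'f => w wD'; rewrite mem_cat wD'.
  by apply: gen_sub => w wD; rewrite mem_cat wD orbT.
exists (gen iota (fun w => w \in D)); split=> //.
- exact: gen1.
- exact: gen_mul.
- exact: (gen_inv gp).
- by apply: colorable_subgraph => s cs _; exact: clq.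
Qed.
End Graph_products.

Local Open Scope ring_scope.

Theorem theorem3p4 (V : countType) (E : rel V) (k n : nat)
    (G : V -> groupType) :
  simplicial_graph E ->
  clique_number_le E k ->
  (forall v, exists S : seq (G v),
      [/\ generates S,
          ~ asdim_le (word_metric S) 0
        & asdim_le (word_metric S) n]) ->
  forall (P : groupType) (iota : forall v, G v -> P),
    is_graph_product E iota ->
    forall d : P -> P -> Real,
      is_metric d -> left_invariant d -> proper_metric d ->
      asdim_le d (n * k).
Proof.
move=> simple clq dims P iota gp d dm dl dp; apply: asdim_le_colorable => //.
have vdim v : colorable n.+1 (fun _ : G v => True).
  by have [S [gS _ dS]] := dims v; exact: colorable_word_metric dS.
(* Positivity of [n] is deduced from a vertex; the empty graph, whose product is trivial, is treated
   apart. *)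
have [v_ex|noV] := pselect (exists v : V, True).
  have n_gt0 : (0 < n)%N.
    have [v _] := v_ex; have [S [_ nd0 dn]] := dims v.
    by rewrite lt0n; apply/eqP => n0; rewrite n0 in dn.
  exact: (colorable_graph_product simple gp n_gt0 vdim clq).
have triv (x : P) : x = 1%g.
  by elim: (gen_all gp x) => // v; case: noV; exists v.
move=> F; exists (fun=> 0%N), [:: 1%g]; split=> // i x y _.
by rewrite (triv x) (triv y) mulVg mem_head.
Qed.
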